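(* Let $W_n^{0,\rm J}(x_1,\dots,x_n;N,a,b)$ be the leading low temperature coefficient of the $n$-point function of the Jacobi $\beta$-ensemble with weight $x^{\beta a/2}(1-x)^{\beta b/2}\chi_{0<x<1}$, and $W_n^{0,\rm J^*}(x_1,\dots,x_n;\alpha,a,b)$ the scaled high temperature limit of the $n$-point function of the Jacobi $\beta$-ensemble with weight $x^a(1-x)^b\chi_{0<x<1}$, with respective expansion coefficients $\mu^{0,\rm J}_{p_1,\dots,p_n}(N,a,b)$ and $\mu^{0,\rm J^*}_{p_1,\dots,p_n}(\alpha,a,b)$. Then for every $n\ge1$, with the parameter $\alpha$ denoted by $N$ (a continuous variable), $$W_n^{0,\rm J^*}(x_1,\dots,x_n;N,a,b)=\frac{(-1)^n}{N}\,W_n^{0,\rm J}(x_1,\dots,x_n;-N,-a,-b)$$ and, for all nonnegative integers $p_1,\dots,p_n$, $$\mu^{0,\rm J^*}_{p_1,\dots,p_n}(N,a,b)=\frac{(-1)^n}{N}\,\mu^{0,\rm J}_{p_1,\dots,p_n}(-N,-a,-b).$$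
   Context: For a weight $w$ on $(0,1)$ and $\kappa=\beta/2>0$, consider the density on $(0,1)^N$ proportional to $\prod_{l=1}^Nw(\lambda_l)\prod_{1\le j<k\le N}|\lambda_k-\lambda_j|^{2\kappa}$. Let $\mu_{p_1,\dots,p_n}$ be the mixed (joint) cumulant of $\sum_j\lambda_j^{p_1},\dots,\sum_j\lambda_j^{p_n}$ (for $n=1$, the moment $\langle\sum_j\lambda_j^{p_1}\rangle$), and define the formal series $\overline W_n(x_1,\dots,x_n)=\frac1{x_1\cdots x_n}\sum_{p_1,\dots,p_n\ge0}\mu_{p_1,\dots,p_n}x_1^{-p_1}\cdots x_n^{-p_n}$. Write $\overline W_n^{\rm J}(x_1,\dots,x_n;N,\kappa,a,b)$ for weight $w(x)=x^{\kappa a}(1-x)^{\kappa b}$ and $\overline W_n^{\rm J^*}(x_1,\dots,x_n;N,\kappa,a,b)$ for weight $w(x)=x^a(1-x)^b$. The quantities in the claim are defined (coefficientwise) by the leading terms $$\overline W_n^{\rm J}(x_1,\dots,x_n;N,\kappa,a,b)=\frac1{\kappa^{n-1}}W_n^{0,\rm J}(x_1,\dots,x_n;N,a,b)+\cdots\quad(\kappa\to\infty),$$ $$\frac1N\overline W_n^{\rm J^*}(x_1,\dots,x_n;N,\kappa,a,b)\Big|_{\kappa=\alpha/N}=W_n^{0,\rm J^*}(x_1,\dots,x_n;\alpha,a,b)+\cdots\quad(N\to\infty,\ \alpha\text{ fixed}),$$ with expansions $$W_n^{0,\rm J}(x_1,\dots,x_n;N,a,b)=\frac1{x_1\cdots x_n}\sum_{p_1,\dots,p_n\ge0}\frac{\mu^{0,\rm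 J}_{p_1,\dots,p_n}(N,a,b)}{x_1^{p_1}\cdots x_n^{p_n}},\qquad W_n^{0,\rm J^*}(x_1,\dots,x_n;\alpha,a,b)=\frac1{x_1\cdots x_n}\sum_{p_1,\dots,p_n\ge0}\frac{\mu^{0,\rm J^*}_{p_1,\dots,p_n}(\alpha,a,b)}{x_1^{p_1}\cdots x_n^{p_n}}.$$ The coefficients are rational functions of $(N,a,b)$, respectively $(\alpha,a,b)$, and are extended to general parameter values as such. Identities are between rational functions, respectively formal series with such coefficients. *)

(* Defs.v *)
From HB Require Import structures.
From mathcomp Require Import all_boot all_order all_algebra fraction.
From mathcomp Require mpoly.
From mathcomp Require Import reals.
Import Order.TTheory GRing.Theory Num.Theory.

Set Implicit Arguments.
Unset Strict Implicit.
Unset Printing Implicit Defensive.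

Local Open Scope ring_scope.

Module RatFun3.
(* mpoly and the analysis library declare incompatible notations, so mpoly is
   only imported inside this module. *)
Import mpoly.
Local Notation tofrac := (@FracField.tofrac _).

(* The field R(N, a, b) of rational functions in three variables; the variables
   N (respectively alpha), a and b are 'X_0, 'X_1 and 'X_2. *)
Definition ratfun3 (R : realType) : fieldType := {fraction {mpoly R[3]}}.

Definition ratfun3_N (R : realType) : ratfun3 R :=
  tofrac ('X_0 : {mpoly R[3]}).

(* f is regular at (N, a, b) and has value y there: this asks for some
   representation of f as a quotient whose denominator does not vanish at
   (N, a, b); by ratfun3_value_inj below, y does not depend on which one. *)
Definition ratfun3_value (R : realType) (f : ratfun3 R) (N a b y : R) : Prop :=
  let v := tnth [tuple N; a; b] in
  exists P Q : {mpoly R[3]},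
    [/\ f = tofrac P / tofrac Q,
        Q.@[v] != 0 & y = P.@[v] / Q.@[v] ].

(* P(-N, -a, -b) *)
Definition mpoly3_neg (R : realType) (P : {mpoly R[3]}) : {mpoly R[3]} :=
  P \mPo [tuple - 'X_i | i < 3].

(* f(-N, -a, -b), computed on the representative [repr f]; by ratfun3_neg_frac
   below, any other representative gives the same result. *)
Definition ratfun3_neg (R : realType) (f : ratfun3 R) : ratfun3 R :=
  tofrac (mpoly3_neg (\n_(repr f))) /
  tofrac (mpoly3_neg (\d_(repr f))).

Lemma tofrac_div_eq (R : realType) (P Q P' Q' : {mpoly R[3]}) :
  Q != 0 -> Q' != 0 ->
  tofrac P / tofrac Q =
    tofrac P' / tofrac Q' <-> P * Q' = P' * Q.
Proof.
move=> Q0 Q'0; split=> [|E].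
  move/eqP; rewrite eqr_div ?tofrac_eq0 // -!tofracM tofrac_eq.
  by move/eqP.
by apply/eqP; rewrite eqr_div ?tofrac_eq0 // -!tofracM tofrac_eq E.
Qed.

Lemma ratfun3_value_inj (R : realType) (f : ratfun3 R) (N a b y z : R) :
  ratfun3_value f N a b y -> ratfun3_value f N a b z -> y = z.
Proof.
rewrite /ratfun3_value; set v := tnth _.
move=> [P [Q [-> Qv ->]]] [P' [Q' [E Q'v ->]]].
have nz (S : {mpoly R[3]}) : S.@[v] != 0 -> S != 0.
  by apply: contraNneq => ->; rewrite meval0.
move/(tofrac_div_eq _ _ (nz _ Qv) (nz _ Q'v)): E => E.
by apply/eqP; rewrite eqr_div // -!mevalM E.
Qed.

Lemma mpoly3_negM (R : realType) (P Q : {mpoly R[3]}) :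
  mpoly3_neg (P * Q) = mpoly3_neg P * mpoly3_neg Q.
Proof. exact: rmorphM. Qed.

Lemma mpoly3_negK (R : realType) : involutive (@mpoly3_neg R).
Proof.
move=> P; rewrite /mpoly3_neg; set t := [tuple _ | _ < _].
rewrite (comp_mpolyEX P) (raddf_sum (comp_mpoly t)) [RHS]mpolyE.
apply: eq_bigr => m _; rewrite /= comp_mpolyZ; congr (_ *: _).
rewrite comp_mpolyX (rmorph_prod (comp_mpoly t)) [RHS]mpolyXE_id.
apply: eq_bigr => i _; rewrite /= (rmorphXn (comp_mpoly t)) /= tnth_mktuple.
by rewrite (raddfN (comp_mpoly t)) /= comp_mpolyXU -tnth_nth tnth_mktuple opprK.
Qed.

Lemma mpoly3_neg_eq0 (R : realType) (P : {mpoly R[3]}) :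
  (mpoly3_neg P == 0) = (P == 0).
Proof.
rewrite -[0 in LHS](raddf0 (comp_mpoly [tuple - 'X_i | i < 3])).
exact: (inj_eq (can_inj (@mpoly3_negK R))).
Qed.

Lemma ratfun3_numden (R : realType) (f : ratfun3 R) :
  f = tofrac \n_(repr f) / tofrac \d_(repr f).
Proof.
rewrite -[LHS]reprK /ratfun3; move: (repr f) => x.
unlock tofrac.
rewrite -[X in _ = _ * X]FracField.pi_inv -[RHS]FracField.pi_mul.
rewrite /FracField.invf /FracField.mulf !numden_Ratio ?oner_neq0 ?mul1r ?mulr1 ?denom_ratioP //.
by rewrite Ratio_numden.
Qed.

Lemma ratfun3_neg_frac (R : realType) (P Q : {mpoly R[3]}) : Q != 0 ->
  ratfun3_neg (tofrac P / tofrac Q : ratfun3 R) =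
  tofrac (mpoly3_neg P) / tofrac (mpoly3_neg Q).
Proof.
move=> Q0; rewrite /ratfun3_neg; set f : ratfun3 R := tofrac P / tofrac Q.
have d0 : \d_(repr f) != 0 by exact: denom_ratioP.
have nd : mpoly3_neg \d_(repr f) != 0 by rewrite mpoly3_neg_eq0.
have nQ : mpoly3_neg Q != 0 by rewrite mpoly3_neg_eq0.
apply: (proj2 (tofrac_div_eq _ _ nd nQ)); rewrite -!mpoly3_negM; congr mpoly3_neg.
exact: (proj1 (tofrac_div_eq _ _ d0 Q0) (esym (ratfun3_numden _))).
Qed.

End RatFun3.

From mathcomp Require Import all_classical all_reals all_analysis.
Import numFieldNormedType.Exports.
Export RatFun3.

Local Open Scope ring_scope.

(* A formal power series in 1/x_1, ..., 1/x_n is given by its coefficients: the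
   value at e is the coefficient of x_1^{-e_1} ... x_n^{-e_n}. *)
Definition formal_series (n : nat) (K : Type) : Type := n.-tuple nat -> K.

(* (x_1 ... x_n)^{-1} \sum_p mu_p x_1^{-p_1} ... x_n^{-p_n} *)
Definition generating_series (K : nmodType) (n : nat) (mu : n.-tuple nat -> K) :
    formal_series n K :=
  fun e => if all (leq 1) e then mu (map_tuple predn e) else 0.

(* Iterated Lebesgue integral over (0,1)^N.  It is only applied to nonnegative
   integrands, for which the order of integration is irrelevant by Tonelli. *)
Fixpoint cube_integral (R : realType) (N : nat) :
    (N.-tuple R -> \bar R) -> \bar R :=
  match N with
  | 0 => fun f => f [tuple]
  | N'.+1 => fun f =>
      (\int[lebesgue_measure]_(x in `]0%R, 1%R[%classic)
         cube_integral (fun t : N'.-tuple R => f [tuple of x :: t]))%E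
  end.

Definition ensemble_density (R : realType) (w : R -> R) (kappa : R) (N : nat)
    (t : N.-tuple R) : R :=
  (\prod_(l < N) w (tnth t l)) *
  \prod_(j < N) \prod_(k < N | (j < k)%N)
     `|tnth t k - tnth t j| `^ (2 * kappa).

Definition ensemble_mean (R : realType) (w : R -> R) (kappa : R) (N : nat)
    (f : N.-tuple R -> R) : R :=
  fine (cube_integral (fun t => (f t * ensemble_density w kappa t)%:E)) /
  fine (cube_integral (fun t : N.-tuple R => (ensemble_density w kappa t)%:E)).

Definition power_sum (R : realType) (N p : nat) (t : N.-tuple R) : R :=
  \sum_(j < N) tnth t j ^+ p.

(* Joint cumulant of X_1, ..., X_n with respect to the expectation E:
   \sum_P (-1)^{|P|-1} (|P|-1)! \prod_{B in P} E[\prod_{i in B} X_i], the sum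
   being over the set partitions P of {1, ..., n}. *)
Definition joint_cumulant (R : realType) (T : Type) (E : (T -> R) -> R)
    (n : nat) (X : 'I_n -> T -> R) : R :=
  \sum_(P : {set {set 'I_n}} | finset.partition P (finset.setT : {set 'I_n}))
     (-1) ^+ #|P|.-1 * (#|P|.-1)`!%:R *
     \prod_(B in P) E (fun t => \prod_(i in B) X i t).

Definition mixed_cumulant (R : realType) (w : R -> R) (kappa : R) (N n : nat)
    (p : n.-tuple nat) : R :=
  joint_cumulant (@ensemble_mean R w kappa N)
    (fun (i : 'I_n) (t : N.-tuple R) => power_sum (tnth p i) t).

Definition weightJ (R : realType) (kappa a b x : R) : R :=
  x `^ (kappa * a) * (1 - x) `^ (kappa * b).

Definition weightJs (R : realType) (a b x : R) : R :=
  x `^ a * (1 - x) `^ b.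

(* mu n p is the rational function mu^{0,J}_{p_1, ..., p_n}(N, a, b): its values
   are the coefficients of the leading term kappa^{-(n-1)} as kappa -> +oo.
   It may be singular at some positive integer N and a, b > 0 (for n = 1 and
   p = 2 it has a pole along a + b + 2N = 3), whence the restriction to the
   points where it is regular; these are Zariski dense, so that mu n p is
   uniquely determined. *)
Definition low_temperature_coefficients (R : realType)
    (mu : forall n : nat, n.-tuple nat -> ratfun3 R) : Prop :=
  forall (n : nat) (p : n.-tuple nat), (0 < n)%N ->
  forall (N : nat) (a b y : R), (0 < N)%N -> 0 < a -> 0 < b ->
  ratfun3_value (mu n p) N%:R a b y ->
  (kappa ^+ n.-1 * mixed_cumulant (weightJ kappa a b) kappa N p
     @[kappa --> +oo] --> y)%classic.

(* mu n p is the rational function mu^{0,J*}_{p_1, ..., p_n}(alpha, a, b): its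
   values are the limits of 1/N times the cumulants at kappa = alpha / N. *)
Definition high_temperature_coefficients (R : realType)
    (mu : forall n : nat, n.-tuple nat -> ratfun3 R) : Prop :=
  forall (n : nat) (p : n.-tuple nat), (0 < n)%N ->
  forall (alpha a b y : R), 0 < alpha -> -1 < a -> -1 < b ->
  ratfun3_value (mu n p) alpha a b y ->
  (N%:R^-1 * mixed_cumulant (weightJs a b) (alpha / N%:R) N p
     @[N --> \oo] --> y)%classic.

(* Main.v *)
(* Both families of coefficients are determined by loop equations.  Integrating
   sum_j d/dt_j (t_j^(r+1) (1 - t_j) P_(s_1) ... P_(s_k) density) over the cube,
   with P_q the power sums, gives a relation between moments, and hence between
   cumulants, valid for all parameters.  Under either scaling the joint cumulants
   with k + 2 arguments drop out of the limit, which leaves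
     c1 m(r, s) - c2 m(r+1, s) + theta (S_r - S_(r+1)) + (D_r - D_(r+1)) = 0,
   where S_q sums m(u, s_A) m(q - u, s_B) over u <= q and the splittings of s into
   s_A and s_B, D_q sums s_i m(q + s_i, s without s_i), and
     c1 = a - (r+1), c2 = a + b - (r+2), theta = 1, m(0) = N  (low temperature),
     c1 = a + (r+1), c2 = a + b + (r+2), theta = alpha, m(0) = 1  (high).
   The substitution (N, a, b) -> (-N, -a, -b) and the factor (-1)^n / N exchange
   the two systems, and the second one has a unique solution, by recursion on the
   number of arguments and then on the first one.  The equations hold at the
   regular points of a Zariski dense set, hence as identities of rational
   functions. *)

(* Both limits and the duality rest on one count. Put k = size s. In the loop equation the linear
   terms are single cumulants with k + 1 arguments, the merged terms single cumulants with k, the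
   joint terms single cumulants with k + 2, and the split terms products of two cumulants with k + 2
   arguments in all. Writing each cumulant as g eps^(number of arguments) times a rescaled one and
   dividing by g eps^k leaves the factors eps, 1, kappa eps^2 and kappa g eps^2. For g = kappa, eps
   = 1/kappa the last two are 1/kappa and 1; for g = N, eps = 1, kappa = alpha/N they are alpha/N
   and alpha. The duality is a rescaling of the same kind with eps = -1. The obstacle in the
   analysis is the diagonal t_a = t_b, where the interaction is not differentiable for the small
   kappa of the high temperature regime. Integration by parts is done for a smoothed interaction,
   and the smoothing is removed only after the sum over j, when the singular terms have combined
   into divided differences. *)
Require Import Defs.
From HB Require Import structures.
From mathcomp Require Import all_boot all_order all_algebra fraction.
From mathcomp Require mpoly boolp.
From mathcomp Require Import ring reals.
Import Order.TTheory GRing.Theory Num.Theory.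

Set Implicit Arguments.
Unset Strict Implicit.
Unset Printing Implicit Defensive.

Local Open Scope ring_scope.

(** * Rational functions at generic points *)

Module RatFun3Theory.
Import mpoly.
Local Notation tofrac := (@FracField.tofrac _).

Definition infinite_pred (T : eqType) (A : T -> Prop) : Prop :=
  forall s : seq T, exists2 x, A x & x \notin s.

Lemma poly_infinite_nonroot (R : idomainType) (p : {poly R}) (A : R -> Prop) :
  infinite_pred A -> p != 0 -> exists2 x, A x & p.[x] != 0.
Proof.
move=> Ainf p0.
have pick (s : seq R) : (forall x, x \in s -> A x) ->
    forall k, exists s', [/\ uniq s', size s' = k & forall x, x \in s' -> A x].
  move=> _; elim=> [|k [s' [us' <- sA]]]; first by exists [::].
  have [x Ax xs'] := Ainf s'; exists (x :: s'); split=> //=.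
    by rewrite xs'.
  by move=> y /[!inE] /predU1P[->|/sA].
have [//|s [us ss sA]] := pick [::] _ (size p).
have : ~~ all (root p) s.
  by apply: contraL (leqnn (size s)) => rs; rewrite -ltnNge {2}ss max_poly_roots.
by move=> /allPn[x /sA Ax nx]; exists x.
Qed.

(** Induction on the number of variables: [muni] views P as a polynomial in the last variable.
    Values of the other variables are chosen to keep one of its coefficients nonzero, and the
    univariate case then provides the last value. *)
Lemma mpoly_infinite_nonroot (R : idomainType) (n : nat) (P : {mpoly R[n]})
    (A : 'I_n -> R -> Prop) :
  (forall i, infinite_pred (A i)) -> P != 0 ->
  exists2 v : 'I_n -> R, (forall i, A i (v i)) & P.@[v] != 0.
Proof.
elim: n P A => [|n IHn] P A Ainf P0.
  exists (fun=> 0); first by case.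
  move: P0; apply: contraNneq => P0; apply/eqP/mpolyP => m; rewrite mcoeff0.
  have {m}-> : m = 0%MM by apply/mnmP; case.
  rewrite -P0 mevalE; have [->|P1] := eqVneq P 0.
    by rewrite mcoeff0 msupp0 big_nil.
  have: perm_eq (msupp P) [:: 0%MM].
    apply: uniq_perm; rewrite ?msupp_uniq // => m; rewrite !inE.
    have -> : m = 0%MM by apply/mnmP; case.
    rewrite eqxx mcoeff_msupp; apply: contraNneq P1 => P1; apply/eqP/mpolyP => m'.
    by rewrite mcoeff0 -P1; congr (P@_ _); apply/mnmP; case.
  by move/(perm_big _)=> ->; rewrite big_seq1 big_ord0 mulr1.
pose w (i : 'I_n) : 'I_n.+1 := widen_ord (leqnSn n) i.
(* [insub] sends the last index to [None], so [oapp v x] is the point [v] extended by [x]. *)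
have muni_eval v x : P.@[fun i => oapp v x (insub (i : nat))] =
    (map_poly (meval v) (muni P)).[x].
  rewrite muniE rmorph_sum horner_sum mevalE; apply: eq_bigr => m _ /=.
  rewrite -[_ *: 'X^_]mul_polyC rmorphM /= map_polyC map_polyXn hornerM hornerC.
  rewrite hornerXn /= mevalZ mevalX -mulrA big_ord_recr /= insubN ?ltnn //=.
  congr (_ * (_ * _)); apply: eq_bigr => i _; rewrite mnmE.
  by rewrite -[X in insub X]/(nat_of_ord i) valK.
(* The coefficient of a monomial [m] of P can be read off [muni P]: take the coefficient of degree
   [m ord_max], then that of the restriction of [m] to the first n variables. *)
have muniP0 : muni P != 0.
  have := mlead_supp P0; move: (mlead P) => m mP.
  pose c (q : {poly {mpoly R[n]}}) := (q`_(m ord_max))@_[multinom m (w i) | i < n].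
  suff cE : c (muni P) = P@_m.
    apply: contraTneq mP => muP0; rewrite -mcoeff_eq0 -cE muP0 /c coef0.
    by rewrite mcoeff0.
  rewrite /c muniE coef_sum raddf_sum /= (bigD1_seq m) ?msupp_uniq //=.
  rewrite coefZ coefXn eqxx mulr1 mcoeffZ mcoeffX eqxx mulr1 big1 ?addr0 // => m' m'm.
  rewrite coefZ coefXn; case: eqP => [Ek|]; last by rewrite mulr0 mcoeff0.
  rewrite mulr1 mcoeffZ mcoeffX; case: eqP => [E|]; last by rewrite mulr0.
  case/eqP: m'm; apply/mnmP => i; have [|ni] := ltnP i n.
    move=> ltin; have -> : i = w (Ordinal ltin) by exact: val_inj.
    by have := congr1 (fun m0 : 'X_{1..n} => m0 (Ordinal ltin)) E; rewrite !mnmE.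
  have -> // : i = ord_max.
  by apply: val_inj; apply/eqP; rewrite eqn_leq ni -ltnS ltn_ord.
have [k ck] : exists k, (muni P)`_k != 0.
  by exists (size (muni P)).-1; rewrite -lead_coefE lead_coef_eq0.
have [v Av Pv] := IHn _ (fun i => A (w i)) (fun i => Ainf _) ck.
have mv0 : map_poly (meval v) (muni P) != 0.
  by apply: contraNneq Pv => E; rewrite -coef_map E coef0.
have [x Ax nx] := poly_infinite_nonroot (Ainf ord_max) mv0.
exists (fun i : 'I_n.+1 => oapp v x (insub (i : nat))); last by rewrite muni_eval.
move=> i /=; case: insubP => [j _ ji|] /=.
  by have -> : i = w j by exact: val_inj.
rewrite -leqNgt => ni; have -> // : i = ord_max.
by apply: val_inj; apply/eqP; rewrite eqn_leq ni -ltnS ltn_ord.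
Qed.

Section Values.
Variable R : realType.
Implicit Types (f g : ratfun3 R) (N a b : R).

Definition ratfun3_a : ratfun3 R := tofrac ('X_1 : {mpoly R[3]}).
Definition ratfun3_b : ratfun3 R := tofrac ('X_2 : {mpoly R[3]}).

Let valueP f N a b y (P Q : {mpoly R[3]}) :
  f = tofrac P / tofrac Q -> Q.@[tnth [tuple N; a; b]] != 0 ->
  y = P.@[tnth [tuple N; a; b]] / Q.@[tnth [tuple N; a; b]] ->
  ratfun3_value f N a b y.
Proof. by move=> *; exists P, Q. Qed.

Lemma ratfun3_value_tofrac (P : {mpoly R[3]}) N a b :
  ratfun3_value (tofrac P) N a b P.@[tnth [tuple N; a; b]].
Proof.
apply: (valueP (P := P) (Q := 1)); rewrite ?tofrac1 ?divr1 ?meval1 ?oner_eq0 //.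
by rewrite divr1.
Qed.

Lemma ratfun3_value_N N a b : ratfun3_value (ratfun3_N R) N a b N.
Proof. by have := ratfun3_value_tofrac 'X_0 N a b; rewrite mevalXU. Qed.

Lemma ratfun3_value_a N a b : ratfun3_value ratfun3_a N a b a.
Proof. by have := ratfun3_value_tofrac 'X_1 N a b; rewrite mevalXU. Qed.

Lemma ratfun3_value_b N a b : ratfun3_value ratfun3_b N a b b.
Proof. by have := ratfun3_value_tofrac 'X_2 N a b; rewrite mevalXU. Qed.

Lemma ratfun3_value_nat n N a b : ratfun3_value n%:R N a b n%:R.
Proof.
have := ratfun3_value_tofrac n%:R N a b.
by rewrite rmorph_nat /ratfun3 rmorph_nat.
Qed.

Lemma ratfun3_valueD f g N a b y z :
  ratfun3_value f N a b y -> ratfun3_value g N a b z ->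
  ratfun3_value (f + g) N a b (y + z).
Proof.
move=> [P [Q [-> Q0 ->]]] [P' [Q' [-> Q'0 ->]]].
have nz (S : {mpoly R[3]}) : S.@[tnth [tuple N; a; b]] != 0 -> S != 0.
  by apply: contraNneq => ->; rewrite meval0.
apply: (valueP (P := P * Q' + P' * Q) (Q := Q * Q')).
- by rewrite addf_div ?tofrac_eq0 ?nz // tofracD !tofracM.
- by rewrite mevalM mulf_neq0.
- by rewrite addf_div // mevalD !mevalM.
Qed.

Lemma ratfun3_valueM f g N a b y z :
  ratfun3_value f N a b y -> ratfun3_value g N a b z ->
  ratfun3_value (f * g) N a b (y * z).
Proof.
move=> [P [Q [-> Q0 ->]]] [P' [Q' [-> Q'0 ->]]].
apply: (valueP (P := P * P') (Q := Q * Q')).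
- by rewrite mulf_div !tofracM.
- by rewrite mevalM mulf_neq0.
- by rewrite mulf_div !mevalM.
Qed.

Lemma ratfun3_valueN f N a b y :
  ratfun3_value f N a b y -> ratfun3_value (- f) N a b (- y).
Proof.
move=> [P [Q [-> Q0 ->]]].
apply: (valueP (P := - P) (Q := Q)) => //; first by rewrite tofracN mulNr.
by rewrite mevalN mulNr.
Qed.

Lemma ratfun3_valueB f g N a b y z :
  ratfun3_value f N a b y -> ratfun3_value g N a b z ->
  ratfun3_value (f - g) N a b (y - z).
Proof. by move=> fy /ratfun3_valueN; exact: ratfun3_valueD. Qed.

Lemma ratfun3_value_sum (I : Type) (r : seq I) (P : pred I) (F : I -> ratfun3 R)
    (y : I -> R) N a b : (forall i, P i -> ratfun3_value (F i) N a b (y i)) ->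
  ratfun3_value (\sum_(i <- r | P i) F i) N a b (\sum_(i <- r | P i) y i).
Proof.
move=> Fy; apply: (big_rec2 (fun f y => ratfun3_value f N a b y)) => [|i z f].
  exact: ratfun3_value_nat 0 _ _ _.
by move=> /Fy; exact: ratfun3_valueD.
Qed.

(* Phi holds off a proper algebraic subset of R^3. *)
Definition generically (Phi : R -> R -> R -> Prop) : Prop :=
  exists2 D : {mpoly R[3]}, D != 0 &
    forall N a b, D.@[tnth [tuple N; a; b]] != 0 -> Phi N a b.

(** A finite product of nonzero polynomials is nonzero; finiteness of [s] is what allows a single
    exceptional set. *)
Lemma generically_all (T : eqType) (s : seq T) (Phi : T -> R -> R -> R -> Prop) :
  (forall i, generically (Phi i)) ->
  generically (fun N a b => forall i, i \in s -> Phi i N a b).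
Proof.
move=> gen; elim: s => [|i s [D D0 DP]].
  by exists 1; rewrite ?oner_eq0.
have [D' D'0 D'P] := gen i; exists (D' * D); first by rewrite mulf_neq0.
move=> N a b; rewrite mevalM mulf_eq0 negb_or => /andP[DN D'N] j.
by rewrite inE => /predU1P[->|/DP]; [exact: D'P | exact].
Qed.

Lemma generically_regular f :
  generically (fun N a b => exists y, ratfun3_value f N a b y).
Proof.
exists \d_(repr f); first exact: denom_ratioP.
move=> N a b D; eexists; apply: valueP (D) _; last by [].
exact: ratfun3_numden.
Qed.

(** If the numerator of f were nonzero, its product with the denominator and with D would be nonzero
    at some point of A1 x A2 x A3, and f would have a nonzero value there. *)
Lemma generically_eq0 f (A1 A2 A3 : R -> Prop) :
  infinite_pred A1 -> infinite_pred A2 -> infinite_pred A3 ->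
  generically (fun N a b => A1 N -> A2 a -> A3 b -> ratfun3_value f N a b 0) ->
  f = 0.
Proof.
move=> A1i A2i A3i [D D0 DP]; have := ratfun3_numden f.
set P := \n__; set Q := \d__ => fE.
have Q0 : Q != 0 by exact: denom_ratioP.
have [P0|P0] := eqVneq P 0; first by rewrite fE P0 tofrac0 mul0r.
pose A (i : 'I_3) : R -> Prop := tnth [tuple A1; A2; A3] i.
have Ai i : infinite_pred (A i) by case: i => [[|[|[|//]]]] i3.
have [v Av] := mpoly_infinite_nonroot Ai (mulf_neq0 (mulf_neq0 D0 P0) Q0).
pose i0 : 'I_3 := @Ordinal 3 0 isT; pose i1 : 'I_3 := @Ordinal 3 1 isT.
pose i2 : 'I_3 := @Ordinal 3 2 isT.
have vE : tnth [tuple v i0; v i1; v i2] =1 v.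
  by case=> [[|[|[|//]]]] i3; rewrite (tnth_nth 0) /=; congr v; exact: val_inj.
rewrite !mevalM !mulf_eq0 !negb_or => /andP[/andP[Dv Pv] Qv].
have := DP (v i0) (v i1) (v i2); rewrite (meval_eq _ vE) => /(_ Dv (Av i0) (Av i1) (Av i2)).
have fv : ratfun3_value f (v i0) (v i1) (v i2) (P.@[v] / Q.@[v]).
  by apply: valueP fE _ _; rewrite !(meval_eq _ vE).
move=> /(ratfun3_value_inj fv)/eqP; rewrite mulf_eq0 invr_eq0.
by rewrite (negPf Pv) (negPf Qv).
Qed.

Lemma ratfun3_neg_tofrac (P : {mpoly R[3]}) :
  ratfun3_neg (tofrac P : ratfun3 R) = tofrac (mpoly3_neg P).
Proof.
have neg1 : mpoly3_neg (1 : {mpoly R[3]}) = 1 by exact: rmorph1.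
have := ratfun3_neg_frac P (oner_neq0 _).
by rewrite neg1 !tofrac1 !divr1.
Qed.

Lemma ratfun3_negD f g : ratfun3_neg (f + g) = ratfun3_neg f + ratfun3_neg g.
Proof.
rewrite [f]ratfun3_numden [g]ratfun3_numden.
set P := \n_(repr f); set Q := \d__; set P' := \n__; set Q' := \d__.
have Q0 : Q != 0 by exact: denom_ratioP.
have Q'0 : Q' != 0 by exact: denom_ratioP.
rewrite addf_div ?tofrac_eq0 // -!tofracM -tofracD !ratfun3_neg_frac ?mulf_neq0 //.
rewrite addf_div ?tofrac_eq0 ?mpoly3_neg_eq0 // -!tofracM -tofracD -!mpoly3_negM.
congr (tofrac _ / _); exact: (raddfD (comp_mpoly _)).
Qed.

Lemma ratfun3_negM f g : ratfun3_neg (f * g) = ratfun3_neg f * ratfun3_neg g.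
Proof.
rewrite [f]ratfun3_numden [g]ratfun3_numden.
set P := \n_(repr f); set Q := \d__; set P' := \n__; set Q' := \d__.
have Q0 : Q != 0 by exact: denom_ratioP.
have Q'0 : Q' != 0 by exact: denom_ratioP.
rewrite mulf_div -!tofracM !ratfun3_neg_frac ?mulf_neq0 //.
by rewrite mulf_div -!tofracM -!mpoly3_negM.
Qed.

Lemma ratfun3_neg1 : ratfun3_neg (1 : ratfun3 R) = 1.
Proof.
have := ratfun3_neg_tofrac 1; rewrite tofrac1 => ->.
by rewrite [mpoly3_neg 1]rmorph1 tofrac1.
Qed.

Lemma ratfun3_neg0 : ratfun3_neg (0 : ratfun3 R) = 0.
Proof. by apply/(addIr (ratfun3_neg 0)); rewrite -ratfun3_negD !add0r. Qed.

Lemma ratfun3_negN f : ratfun3_neg (- f) = - ratfun3_neg f.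
Proof. by apply/(addIr (ratfun3_neg f)); rewrite -ratfun3_negD !addNr ratfun3_neg0. Qed.

Lemma ratfun3_neg_is_zmod_morphism : zmod_morphism (@ratfun3_neg R).
Proof. by move=> f g; rewrite ratfun3_negD ratfun3_negN. Qed.

Lemma ratfun3_neg_is_monoid_morphism : monoid_morphism (@ratfun3_neg R).
Proof. by split; [exact: ratfun3_neg1 | exact: ratfun3_negM]. Qed.

(** These structures let [ratfun3_neg] play the part of the abstract morphism [sigma] in the duality
    argument. *)
HB.instance Definition _ := GRing.isZmodMorphism.Build (ratfun3 R) (ratfun3 R)
  (@ratfun3_neg R) ratfun3_neg_is_zmod_morphism.
HB.instance Definition _ := GRing.isMonoidMorphism.Build (ratfun3 R) (ratfun3 R)
  (@ratfun3_neg R) ratfun3_neg_is_monoid_morphism.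

Let ratfun3_neg_var (i : 'I_3) :
  ratfun3_neg (tofrac 'X_i : ratfun3 R) = - tofrac ('X_i : {mpoly R[3]}).
Proof.
rewrite ratfun3_neg_tofrac -tofracN; congr tofrac.
by rewrite /mpoly3_neg comp_mpolyXU -tnth_nth tnth_mktuple.
Qed.

Lemma ratfun3_neg_N : ratfun3_neg (ratfun3_N R) = - ratfun3_N R.
Proof. exact: ratfun3_neg_var. Qed.

Lemma ratfun3_neg_a : ratfun3_neg ratfun3_a = - ratfun3_a.
Proof. exact: ratfun3_neg_var. Qed.

Lemma ratfun3_neg_b : ratfun3_neg ratfun3_b = - ratfun3_b.
Proof. exact: ratfun3_neg_var. Qed.

End Values.

Lemma ratfun3_N_neq0 (R : realType) : ratfun3_N R != 0.
Proof.
apply/eqP => E; have := ratfun3_value_N (1 : R) 0 0; rewrite E => N1.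
have := ratfun3_value_inj N1 (ratfun3_value_nat 0 1 0 0).
by move/eqP; rewrite oner_eq0.
Qed.

End RatFun3Theory.

(** * Cumulants and subset convolution *)

Section SubsetConvolution.
Variables (K : comNzRingType) (T : finType).
Implicit Types (F G H M : {set T} -> K) (S A B : {set T}).

(** The product of set functions seen as generating polynomials in variables indexed by T, modulo
    the squares of the variables. *)
Definition set_conv F G S : K :=
  \sum_(A : {set T} | A \subset S) F A * G (S :\: A)%SET.

(** Both sides sum F A * G B * H C over the ordered splittings of S into three disjoint sets; the
    reindexing passes from the pair (A, B) to (A :|: B, A). *)
Lemma set_convA F G H S :
  set_conv F (set_conv G H) S = set_conv (set_conv F G) H S.
Proof.
rewrite /set_conv.
under eq_bigr do rewrite mulr_sumr.
under [RHS]eq_bigr do rewrite mulr_suml.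
rewrite !pair_big_dep /=.
rewrite [RHS](reindex_onto (fun p : {set T} * {set T} => (p.1 :|: p.2, p.1)%SET)
  (fun p : {set T} * {set T} => (p.2, p.1 :\: p.2)%SET)) /=; last first.
  case=> A B /= /andP[_ BA]; congr pair.
  by rewrite -{1}(setIidPr BA) setID.
apply: eq_big => [[A B]|[A B] /= /andP[_]].
  rewrite /= subUset subsetUl andbT xpair_eqE eqxx /= setDUl setDv set0U -andbA.
  rewrite finset.subsetD; congr (_ && (_ && _)).
  by apply/setDidPl/eqP.
rewrite finset.subsetD => /andP[_ /setDidPl BA].
by rewrite mulrA setDDl setDUl setDv set0U BA.
Qed.

(** M is invertible for the convolution because its value at [set0] is 1. By induction on the
    cardinal, all terms of the convolution at S vanish except F S itself. *)
Lemma set_conv_cancel F M : M set0 = 1 ->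
  (forall S, set_conv F M S = 0) -> forall S, F S = 0.
Proof.
move=> M0 FM S; have [n] := ubnP #|S|; elim: n S => // n IHn S /ltnSE leSn.
have := FM S; rewrite /set_conv (bigD1 S) //= setDv M0 mulr1.
rewrite big1 ?addr0 // => A /andP[AS nAS]; rewrite IHn ?mul0r //.
by apply: leq_trans (leSn); apply: proper_card; rewrite properEneq nAS.
Qed.

Lemma set_convDl F G M S :
  set_conv (fun A => F A + G A) M S = set_conv F M S + set_conv G M S.
Proof. by rewrite -big_split; apply: eq_bigr => A _; rewrite mulrDl. Qed.

Lemma set_convBl F G M S :
  set_conv (fun A => F A - G A) M S = set_conv F M S - set_conv G M S.
Proof. by rewrite -sumrB; apply: eq_bigr => A _; rewrite mulrBl. Qed.

Lemma set_convZl c F M S : set_conv (fun A => c * F A) M S = c * set_conv F M S.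
Proof. by rewrite mulr_sumr; apply: eq_bigr => A _; rewrite mulrA. Qed.

Lemma set_conv_suml (I : Type) (r : seq I) (P : pred I) (F : I -> {set T} -> K) M S :
  set_conv (fun A => \sum_(i <- r | P i) F i A) M S =
  \sum_(i <- r | P i) set_conv (F i) M S.
Proof. by rewrite exchange_big; apply: eq_bigr => A _; rewrite mulr_suml. Qed.

Lemma set_conv_indicator x F S :
  set_conv (fun A => (A == [set x]%SET)%:R) F S =
  if x \in S then F (S :\ x)%SET else 0.
Proof.
rewrite /set_conv; case: ifP => xS.
  rewrite (bigD1 [set x]%SET) ?sub1set //= eqxx mul1r big1 ?addr0 // => A.
  by case/andP=> _ /negPf->; rewrite mul0r.
by apply: big1 => A AS; case: eqP AS => [->|]; rewrite ?sub1set ?xS ?mul0r.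
Qed.

(** The product rule: A |-> F (x |: A) is the derivative of F with respect to the variable x. The
    two terms correspond to x lying in the first or in the second part. *)
Lemma set_conv_setU1 x F G S : x \notin S ->
  set_conv F G (x |: S) =
  set_conv (fun A => F (x |: A)) G S + set_conv F (fun A => G (x |: A)) S.
Proof.
move=> xS; rewrite /set_conv (bigID (fun A : {set T} => x \in A)) /=; congr (_ + _).
  rewrite (reindex_onto (fun A => x |: A) (fun A => A :\ x)) /= => [|A]; last first.
    by case/andP=> _ xA; rewrite setD1K.
  apply: eq_big => [A|A /andP[_ /eqP AE]].
    rewrite setU11 andbT; apply/andP/idP => [[xA /eqP AE]|AS].
      by rewrite -AE -(setU1K xS); exact: setSD.
    have xA : x \notin A by apply: contra xS => /(subsetP AS).
    by rewrite setU1K ?setUS.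
  congr (_ * G _); apply/setP => y; rewrite !inE.
  by case: eqP => [->|]; rewrite ?(negPf xS) ?andbF.
apply: eq_big => [A|A /andP[_ xA]].
  by rewrite -subsetD1 setU1K.
congr (_ * G _); rewrite setDUl; congr (_ :|: _); apply/setDidPl.
by rewrite disjoints1.
Qed.

End SubsetConvolution.

Lemma set_conv_imset (K : comNzRingType) (T T' : finType) (h : T -> T')
    (F G : {set T'} -> K) (S : {set T}) : injective h ->
  set_conv F G (h @: S) =
  set_conv (fun A : {set T} => F (h @: A)) (fun A : {set T} => G (h @: A)) S.
Proof.
move=> hI; rewrite /set_conv.
have hK (B : {set T}) : h @^-1: (h @: B) = B.
  by apply/setP => y; rewrite inE (mem_imset _ _ hI).
rewrite (reindex_onto (fun A : {set T} => h @: A) (fun A => h @^-1: A)) /=.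
  apply: eq_big => [A|A _].
    rewrite hK eqxx andbT; apply/idP/idP => [/subsetP AS|]; last exact: imsetS.
    by apply/subsetP => y yA; rewrite -(mem_imset S y hI) AS ?imset_f.
  congr (_ * G _); apply/setP => y; rewrite inE.
  apply/andP/imsetP => [[yA /imsetP[z zS yE]]|[z + ->]]; last first.
    by rewrite inE !(mem_imset _ _ hI) => /andP.
  by exists z => //; rewrite inE zS andbT -(mem_imset A z hI) -yE.
move=> A AS; apply/setP => y; apply/imsetP/idP => [[z + ->]|yA]; first by rewrite inE.
have /imsetP[z zA yE] := subsetP AS y yA.
by exists z; rewrite // inE -yE.
Qed.

Section Cumulants.
Variables (K : comNzRingType) (T : finType).
Implicit Types (M : {set T} -> K) (S A B : {set T}) (P Q : {set {set T}}).

(** The formula of [joint_cumulant] for an abstract moment function, so that the arguments may be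
    indexed by any finite type, in particular by nested options. *)
Definition set_cumulant M S : K :=
  \sum_(P : {set {set T}} | partition P S)
     (-1) ^+ #|P|.-1 * (#|P|.-1)`!%:R * \prod_(B in P) M B.

(* On the right, S \: A is either empty or a block avoiding x that can be added
   to the partition of x |: A.  A partition of x |: S with k blocks is thus
   reached k - 1 times with the weight (-1)^(k-2) (k-2)!, which cancels its own
   weight unless k = 1. *)
Lemma moment_cumulant M x S : M set0 = 1 -> x \notin S ->
  M (x |: S) = set_conv (fun A => set_cumulant M (x |: A)) M S.
Proof.
move=> M0 xS; set U := x |: S.
pose w k : K := (-1) ^+ k.-1 * (k.-1)`!%:R.
pose m P := \prod_(B in P) M B.
have partU1 A P : A \proper S -> partition P (x |: A) ->
    [/\ partition ((S :\: A) |: P) U, S :\: A \notin P & S :\: A != set0].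
  move=> ltAS PA; have nSA : S :\: A != set0.
    by rewrite setD_eq0; case/andP: ltAS.
  have dSA : [disjoint S :\: A & x |: A].
    rewrite -setI_eq0; apply/eqP/setP => y; rewrite !inE.
    by case: eqP => [->|_]; rewrite ?(negPf xS) ?andbF //; case: (y \in A); rewrite ?andbF.
  have UE : U = (S :\: A) :|: (x |: A).
    rewrite setUCA; congr (_ |: _); rewrite -{1}(setID S A) finset.setUC.
    by rewrite (setIidPr _) // proper_sub.
  split=> //; first by rewrite UE partitionU1.
  apply: contra nSA => inP; apply/eqP; rewrite -(disjoint_setI0 dSA).
  by apply/esym/setIidPl; exact: partitionS PA inP.
rewrite /set_conv (bigD1 S) //= setDv M0 mulr1.
(* The complement B = S :\: A of a proper subset A becomes a block of Q avoiding x; the weight of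
   the cumulant counts only the other [#|Q|.-1] blocks. *)
have -> : \sum_(A : {set T} | (A \subset S) && (A != S))
    set_cumulant M (x |: A) * M (S :\: A) =
  \sum_(Q | partition Q U) \sum_(B in Q | x \notin B) w #|Q|.-1 * m Q.
  under eq_bigr do rewrite mulr_suml.
  rewrite !pair_big_dep /=.
  rewrite (reindex_onto
    (fun p : {set {set T}} * {set T} => (S :\: p.2, p.1 :\ p.2))
    (fun p : {set T} * {set {set T}} => ((S :\: p.1) |: p.2, S :\: p.1))) /=.
    apply: eq_big => [[Q B] /=|[Q B] /=].
      apply/idP/idP => [/andP[/andP[/andP[_ nS] PB]]|/and3P[QU BQ xB]].
        rewrite xpair_eqE => /andP[/eqP EQ /eqP EB]; rewrite EB in EQ.
        have ltSB : S :\: B \proper S by rewrite properEneq nS subsetDl.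
        have [] := partU1 _ _ ltSB PB; rewrite EB EQ => -> _ _.
        by rewrite -EQ setU11 -EB !inE (negPf xS) andbF.
      have BU := partitionS QU BQ; have B0 := partition_neq0 QU BQ.
      have BS : B \subset S.
        apply/subsetP => y yB; have := subsetP BU y yB; rewrite !inE.
        by case: eqP yB => // ->; rewrite (negPf xB).
      rewrite setDDr setDv set0U (setIidPr BS) setD1K // eqxx andbT subsetDl /=.
      apply/andP; split; first by apply: contra B0 => /eqP/setDidPl; rewrite -setI_eq0 (setIidPr BS).
      suff -> : x |: (S :\: B) = U :\: B by exact: partitionD1.
      by rewrite setDUl; congr (_ :|: _); apply/esym/setDidPl; rewrite disjoints1.
    case/andP=> _; rewrite xpair_eqE => /andP[/eqP EQ /eqP EB].
    rewrite EB in EQ *; have BQ : B \in Q by rewrite -EQ setU11.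
    by rewrite /m (big_setD1 _ BQ) /= (cardsD1 B Q) BQ /w [M B * _]mulrC mulrA.
  move=> [A P] /= /andP[AS PA].
  have [|Q1 nP nA] := partU1 A P _ PA; first by rewrite properEneq andbC.
  by rewrite setDDr setDv set0U (setIidPr _) ?(proj1 (andP AS)) ?setU1K.
rewrite -big_split /=.
have U0 : U != set0 by apply/set0Pn; exists x; rewrite setU11.
have PU : partition [set U] U.
  by rewrite /partition cover1 eqxx trivIset1 inE eq_sym.
rewrite (bigD1 [set U]) //= cards1 /= expr0 mulr1 mul1r big_set1.
rewrite big_pred0 ?addr0 => [|B]; last first.
  by rewrite inE; case: eqP => [->|]; rewrite ?setU11.
rewrite big1 ?addr0 // => Q /andP[QU nQ].
have xU : x \in cover Q by rewrite (cover_partition QU) setU11.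
have [B0 B0Q xB0] := bigcupP xU.
have E B : (B \in Q) && (x \notin B) = (B \in Q :\ B0).
  rewrite !inE andbC; have [BQ|] := boolP (B \in Q); last by rewrite !andbF.
  rewrite !andbT; have [->|nB] := eqVneq B B0; first by rewrite xB0.
  have /trivIsetP/(_ B B0 BQ B0Q nB) := partition_trivIset QU.
  by rewrite disjoint_sym => /(disjointFr)->.
rewrite (eq_bigl _ _ E) sumr_const -/(m Q) (cardsD1 B0 Q) B0Q /=.
have : #|Q :\ B0| != 0%N.
  apply: contra nQ; rewrite cards_eq0 setD_eq0 => QB0.
  have {}QB0 : Q = [set B0].
    by apply/eqP; rewrite finset.eqEsubset QB0 sub1set.
  have -> : U = B0 by rewrite -[LHS](cover_partition QU) QB0 cover1.
  exact/eqP.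
case: #|_| => // k _; rewrite add0n /= factS natrM exprS -mulr_natl /w /=; ring.
Qed.

(** Taking images under an injection is a bijection between the partitions. The left side is
    unfolded so as to match the sum in [joint_cumulant]. *)
Lemma set_cumulant_imset (T' : finType) (h : T' -> T) M (A : {set T'}) :
  injective h ->
  \sum_(P : {set {set T'}} | partition P A) (-1) ^+ #|P|.-1 * (#|P|.-1)`!%:R *
     \prod_(B in P) M (h @: B) = set_cumulant M (h @: A).
Proof.
move=> hI; pose H (P : {set {set T'}}) := [set h @: (B : {set T'}) | B in P].
pose H' (P : {set {set T}}) := [set h @^-1: (B : {set T}) | B in P].
have hK (B : {set T'}) : h @^-1: (h @: B) = B.
  by apply/setP => y; rewrite inE (mem_imset _ _ hI).
have HK (P : {set {set T'}}) : H' (H P) = P.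
  rewrite /H /H' -imset_comp -[RHS]imset_id.
  by apply: eq_in_imset => B _; rewrite /= hK.
rewrite /set_cumulant (reindex_onto H H') => [|P PA].
  apply: eq_big => [P|P _]; first by rewrite HK eqxx andbT imset_partition.
  rewrite card_imset; last exact: imset_inj.
  by rewrite big_imset //=; exact: in2W (imset_inj hI).
rewrite /H /H' -imset_comp -[RHS]imset_id; apply: eq_in_imset => B BP /=.
apply/setP => y; apply/imsetP/idP => [[z + ->]|yB]; first by rewrite inE.
have /imsetP[z zA yE] := subsetP (partitionS PA BP) y yB.
by exists z; rewrite // inE -yE.
Qed.

End Cumulants.

(** Sublists are taken by sets of positions and not of values, since the same exponent may occur
    several times in [s]. *)
Definition subseq_at (s : seq nat) (A : {set 'I_(size s)}) : seq nat :=
  [seq nth 0%N s (i : 'I_(size s)) | i <- enum A].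

Lemma size_subseq_at s (A : {set 'I_(size s)}) : size (subseq_at A) = #|A|.
Proof. by rewrite size_map -cardE. Qed.

Lemma subseq_atT s : subseq_at [set: 'I_(size s)] = s.
Proof.
rewrite /subseq_at enum_setT -enumT -[RHS](mkseq_nth 0%N) /mkseq -val_enum_ord.
by rewrite -map_comp.
Qed.

Section LoopTerms.
Variables (K : comNzRingType) (c : seq nat -> K).

(* The cumulant analogue of E[P_u P_v ...] is a joint cumulant (joined_term) plus
   the products over the splittings of the remaining arguments between u and v
   (split_term); merged_term comes from differentiating a factor P_(s_i). *)
Definition joined_term (m : nat) (s : seq nat) : K :=
  \sum_(u < m.+1) c [:: val u, (m - u)%N & s].

Definition split_term (m : nat) (s : seq nat) : K :=
  \sum_(u < m.+1) \sum_(A : {set 'I_(size s)})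
    c (val u :: subseq_at A) * c ((m - u)%N :: subseq_at (~: A)).

Definition merged_term (m : nat) (s : seq nat) : K :=
  \sum_(i < size s) (nth 0%N s i)%:R * c ((m + nth 0 s i)%N :: subseq_at [set~ i]).

End LoopTerms.

(** * Passage from moment equations to cumulant equations *)

Section LoopEquations.
Variables (R : realType) (Omega : Type) (E : (Omega -> R) -> R).
Variable X : nat -> Omega -> R.
Hypothesis E1 : E (fun=> 1) = 1.

Definition cumulant_seq (s : seq nat) : R :=
  joint_cumulant E (fun i : 'I_(size s) => X (nth 0%N s i)).

Let mom (T : finType) (Y : T -> Omega -> R) (B : {set T}) :=
  E (fun t => \prod_(i in B) Y i t).

(** Trades a list of arguments for a set of indices in any finite type, where the partition
    identities apply; [uniq l] makes the enumeration of the indices injective. *)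
Lemma cumulant_seq_map (T : finType) (p : T -> nat) (l : seq T) : uniq l ->
  cumulant_seq [seq p i | i <- l] =
  set_cumulant (mom (fun i => X (p i))) [set x in l].
Proof.
move=> ul; pose h (i : 'I_(size [seq p i | i <- l])) : T :=
  tnth (in_tuple l) (cast_ord (size_map p l) i).
have hI : injective h.
  by move=> i j /(elimT (tuple_uniqP (in_tuple l)) ul)/cast_ord_inj.
have -> : [set x in l] = h @: [set: 'I_(size [seq p i | i <- l])].
  apply/setP => x; rewrite inE; apply/idP/imsetP => [/(tnthP (in_tuple l))[i ->]|[i _ ->]].
    by exists (cast_ord (esym (size_map p l)) i); rewrite // /h cast_ordKV.
  exact: mem_tnth.
rewrite -set_cumulant_imset //; apply: eq_bigr => P _; congr (_ * _).
apply: eq_bigr => B _; congr E; apply: boolp.funext => t.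
rewrite big_imset; last exact: in2W.
apply: eq_bigr => i _; congr X.
have ltil : (i < size l)%N by rewrite -(size_map p).
rewrite (nth_map (h i)) //; congr p.
by rewrite [RHS]/h (tnth_nth (h i)).
Qed.

Variable s : seq nat.
Let k := size s.
Let p (i : 'I_k) := nth 0%N s i.
Let mom0 := mom (fun i => X (p i)).
Let cum1 u (A : {set 'I_k}) := cumulant_seq (u :: [seq p i | i <- enum A]).
Let cum2 u v (A : {set 'I_k}) := cumulant_seq [:: u, v & [seq p i | i <- enum A]].

Let mom_set0 (T : finType) (Y : T -> Omega -> R) : mom Y set0 = 1.
Proof. by rewrite /mom -E1; congr E; apply: boolp.funext => t; rewrite big_set0. Qed.

Let mom_imset (T T' : finType) (h : T' -> T) (Y : T -> Omega -> R) (A : {set T'}) :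
  injective h -> mom Y (h @: A) = mom (fun i => Y (h i)) A.
Proof.
move=> hI; congr E; apply: boolp.funext => t; rewrite big_imset //; exact: in2W.
Qed.

Let SomeI (T : Type) : injective (@Some T).
Proof. by move=> x y []. Qed.

Let NoneSome (T : finType) (S : {set T}) : None \notin Some @: S.
Proof. by apply/imsetP => -[]. Qed.

(** Adjoins to the index type one fresh index [None] carrying the exponent [u]; used twice, it
    adjoins two. *)
Let opt (T : Type) (f : T -> nat) u (o : option T) := oapp f u o.

Let mom1E u (A : {set 'I_k}) :
  mom (fun o => X (opt p u o)) (None |: Some @: A) =
  E (fun t => X u t * \prod_(i in A) X (p i) t).
Proof.
congr E; apply: boolp.funext => t.
by rewrite big_setU1 ?NoneSome //= big_imset //=; exact: in2W (@SomeI _).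
Qed.

Let mom1_conv u (S : {set 'I_k}) :
  E (fun t => X u t * \prod_(i in S) X (p i) t) = set_conv (cum1 u) mom0 S.
Proof.
rewrite -mom1E moment_cumulant ?mom_set0 ?NoneSome // set_conv_imset; last exact: SomeI.
apply: eq_bigr => A _; congr (_ * _); last by rewrite mom_imset; last exact: SomeI.
rewrite /cum1 -[u :: _]/(u :: [seq opt p u (Some i) | i <- enum A]).
rewrite (map_comp (opt p u)) -[u :: _]/(map (opt p u) (None :: map Some (enum A))).
rewrite cumulant_seq_map /=; last first.
  rewrite map_inj_uniq ?enum_uniq ?andbT; last exact: SomeI.
  by apply/mapP => -[].
congr set_cumulant; apply/setP => -[x|]; rewrite !inE //=.
by rewrite (mem_imset _ _ (@SomeI _)) (mem_map (@SomeI _)) mem_enum.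
Qed.

(** Expand at the index of u and apply the product rule at the index of v. Either v joins the
    cumulant of u, which gives [cum2], or it stays in the moment factor, which [mom1_conv] expands
    in turn; associativity then collects the product of two cumulants. *)
Let mom2_conv u v (S : {set 'I_k}) :
  E (fun t => X u t * X v t * \prod_(i in S) X (p i) t) =
  set_conv (fun A => cum2 u v A + set_conv (cum1 u) (cum1 v) A) mom0 S.
Proof.
pose q := opt (opt p v) u.
have -> : E (fun t => X u t * X v t * \prod_(i in S) X (p i) t) =
    mom (fun o => X (q o)) (None |: Some @: (None |: Some @: S)).
  congr E; apply: boolp.funext => t.
  rewrite big_setU1 ?NoneSome //= big_imset /=; last exact: in2W (@SomeI _).
  by rewrite big_setU1 ?NoneSome //= big_imset /=; [rewrite mulrA|exact: in2W (@SomeI _)].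
rewrite moment_cumulant ?mom_set0 ?NoneSome // set_conv_imset; last exact: SomeI.
rewrite set_conv_setU1 ?NoneSome // !set_conv_imset; try exact: SomeI.
rewrite set_convDl -set_convA; congr (_ + _); apply: eq_bigr => A _.
  congr (_ * _); last first.
    by rewrite mom_imset ?mom_imset //; exact: SomeI.
  rewrite /cum2; pose l := None :: map Some (None :: map Some (enum A)).
  rewrite (_ : [:: u, v & _] = map q l); last by rewrite /= -!map_comp.
  rewrite cumulant_seq_map; last first.
    rewrite /= !map_inj_uniq ?enum_uniq ?andbT; try exact: SomeI.
    rewrite inE /=; apply/andP; split; first by apply/mapP => -[].
    by apply/mapP => -[_ /mapP[x _ ->]].
  congr set_cumulant; apply/setP => -[[x|]|]; rewrite !inE //=.
  + rewrite (mem_imset _ _ (@SomeI _)) !inE /= (mem_imset _ _ (@SomeI _)).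
    by rewrite !(mem_map (@SomeI _)) mem_enum.
  + by rewrite (mem_imset _ _ (@SomeI _)) !inE.
congr (_ * _); last first.
  by rewrite -mom1_conv -mom1E mom_imset //; exact: SomeI.
rewrite /cum1; pose l := None :: map Some (map Some (enum A)).
rewrite (_ : u :: _ = map q l); last by rewrite /= -!map_comp.
rewrite cumulant_seq_map; last first.
  rewrite /= !map_inj_uniq ?enum_uniq ?andbT; try exact: SomeI.
  by apply/mapP => -[].
congr set_cumulant; apply/setP => -[x|]; rewrite !inE //=.
rewrite (mem_imset _ _ (@SomeI _)) (mem_map (@SomeI _)).
case: x => [x|]; first by rewrite (mem_imset _ _ (@SomeI _)) (mem_map (@SomeI _)) mem_enum.
by rewrite (negPf (NoneSome _)); apply/esym/negbTE/mapP => -[].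
Qed.

Let momq m (S : {set 'I_k}) :=
  \sum_(u < m.+1) E (fun t => X u t * X (m - u) t * \prod_(i in S) X (p i) t).
Let cumq m (A : {set 'I_k}) :=
  \sum_(u < m.+1) (cum2 u (m - u) A + set_conv (cum1 u) (cum1 (m - u)) A).
Let momd m (S : {set 'I_k}) := \sum_(i in S)
  (p i)%:R * E (fun t => X (m + p i) t * \prod_(j in S :\ i) X (p j) t).
Let cumd m (A : {set 'I_k}) := \sum_(i in A) (p i)%:R * cum1 (m + p i) (A :\ i).

Let momq_conv m S : momq m S = set_conv (cumq m) mom0 S.
Proof. by rewrite set_conv_suml; apply: eq_bigr => u _; rewrite mom2_conv. Qed.

Let momd_conv m S : momd m S = set_conv (cumd m) mom0 S.
Proof.
(* Deleting i from A is convolution with the indicator of [[set i]], so associativity reduces the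
   claim to [mom1_conv]. *)
pose F i (A : {set 'I_k}) := (p i)%:R *
  set_conv (fun B => (B == [set i])%:R) (cum1 (m + p i)) A.
have -> : set_conv (cumd m) mom0 S = set_conv (fun A => \sum_i F i A) mom0 S.
  apply: eq_bigr => A _; congr (_ * _); rewrite /cumd big_mkcond /=.
  apply: eq_bigr => i _; rewrite /F set_conv_indicator.
  by case: ifP => //; rewrite mulr0.
rewrite set_conv_suml /momd big_mkcond /=; apply: eq_bigr => i _.
rewrite set_convZl -set_convA set_conv_indicator mom1_conv.
by case: ifP => //; rewrite mulr0.
Qed.

Let loop_conv (c1 c2 kappa : R) (r : nat) :
  (forall S : {set 'I_k},
    c1 * E (fun t => X r t * \prod_(i in S) X (p i) t) -
    c2 * E (fun t => X r.+1 t * \prod_(i in S) X (p i) t) +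
    kappa * (momq r S - momq r.+1 S) + (momd r S - momd r.+1 S) = 0) ->
  forall A : {set 'I_k},
    c1 * cum1 r A - c2 * cum1 r.+1 A +
    kappa * (cumq r A - cumq r.+1 A) + (cumd r A - cumd r.+1 A) = 0.
Proof.
move=> loop; apply: (@set_conv_cancel _ _ _ mom0); first exact: mom_set0.
move=> S; rewrite -[RHS](loop S) !mom1_conv !momq_conv !momd_conv.
by rewrite !(set_convBl, set_convDl, set_convZl).
Qed.

(* Both sides of the moment equation are subset convolutions of a cumulant
   expression with the moments, which can be cancelled. *)
Lemma loop_equation_cumulant_seq (c1 c2 kappa : R) (r : nat) :
  let G (S : {set 'I_(size s)}) t := \prod_(i in S) X (nth 0%N s i) t in
  (forall S : {set 'I_(size s)},
    c1 * E (fun t => X r t * G S t) - c2 * E (fun t => X r.+1 t * G S t) +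
    kappa * (\sum_(u < r.+1) E (fun t => X u t * X (r - u) t * G S t) -
             \sum_(u < r.+2) E (fun t => X u t * X (r.+1 - u) t * G S t)) +
    (\sum_(i in S) (nth 0%N s i)%:R *
       E (fun t => X (r + nth 0 s i) t * G (S :\ i) t) -
     \sum_(i in S) (nth 0%N s i)%:R *
       E (fun t => X (r.+1 + nth 0 s i) t * G (S :\ i) t)) = 0) ->
  c1 * cumulant_seq (r :: s) - c2 * cumulant_seq (r.+1 :: s) +
  kappa * (joined_term cumulant_seq r s + split_term cumulant_seq r s -
           (joined_term cumulant_seq r.+1 s + split_term cumulant_seq r.+1 s)) +
  (merged_term cumulant_seq r s - merged_term cumulant_seq r.+1 s) = 0.
Proof.
move=> G /loop_conv/(_ [set: _]).
have cT : [seq p i | i <- enum [set: 'I_k]] = s by exact: subseq_atT.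
have cumdE m : cumd m [set: _] = merged_term cumulant_seq m s.
  by apply: eq_big => [i|i _]; rewrite ?inE // setTD.
have cumqE m : cumq m [set: _] =
    joined_term cumulant_seq m s + split_term cumulant_seq m s.
  rewrite /cumq big_split; congr (_ + _); apply: eq_bigr => u _.
    by rewrite /cum2 cT.
  by apply: eq_big => [A|A _]; rewrite ?subsetT // setTD.
by rewrite !cumqE !cumdE /cum1 cT.
Qed.

(** By hypothesis, [cum1 u] and x times the unit of the convolution have the same convolution with
    the moments, which can be cancelled. A constant thus has no joint cumulants with other
    arguments. *)
Lemma cumulant_seq_const (u : nat) (x : R) :
  (forall S : {set 'I_(size s)},
    E (fun t => X u t * \prod_(i in S) X (nth 0%N s i) t) =
    x * E (fun t => \prod_(i in S) X (nth 0%N s i) t)) ->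
  cumulant_seq (u :: s) = x * (s == [::])%:R.
Proof.
move=> Xu; have : forall A : {set 'I_k}, cum1 u A - x * (A == set0)%:R = 0.
  apply: (@set_conv_cancel _ _ _ mom0); first exact: mom_set0.
  move=> S; rewrite set_convBl -mom1_conv Xu set_convZl /set_conv (bigD1 set0) ?sub0set //=.
  rewrite eqxx mul1r setD0 big1 ?addr0 ?subrr // => A /andP[_ /negPf->].
  by rewrite mul0r.
move=> /(_ [set: _])/eqP; rewrite subr_eq0 /cum1 [X in u :: X]subseq_atT => /eqP->.
by rewrite -cards_eq0 cardsT card_ord size_eq0.
Qed.

End LoopEquations.

(** * Uniqueness of the solution of the leading loop equations *)

Section LoopUniqueness.
Variables (K : fieldType) (c1 c2 : nat -> K) (theta : K).
Implicit Types m : seq nat -> K.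

Definition leading_loop_equation m : Prop := forall r s,
  c1 r * m (r :: s) - c2 r * m (r.+1 :: s) +
  theta * (split_term m r s - split_term m r.+1 s) +
  (merged_term m r s - merged_term m r.+1 s) = 0.

Lemma subseq_at0 s : subseq_at (set0 : {set 'I_(size s)}) = [::].
Proof. by rewrite /subseq_at enum_set0. Qed.

(** At the two ends of the sum one factor has first argument 0, hence vanishes unless all of [s]
    goes to the other factor. Each end therefore contributes m [:: 0] * m (r.+1 :: s), and the inner
    terms have first arguments at most r. *)
Lemma split_termS m r s : (forall s', s' != [::] -> m (0%N :: s') = 0) ->
  split_term m r.+1 s = 2 * m [:: 0%N] * m (r.+1 :: s) +
    \sum_(u < r) \sum_(A : {set 'I_(size s)})
      m (u.+1 :: subseq_at A) * m ((r - u)%N :: subseq_at (~: A)).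
Proof.
move=> m0; rewrite /split_term big_ord_recl big_ord_recr /= subn0 subnn.
have neq0 (A : {set 'I_(size s)}) : A != set0 -> subseq_at A != [::].
  by move=> A0; rewrite -size_eq0 size_subseq_at cards_eq0.
rewrite (bigD1 set0) //= subseq_at0 setC0 subseq_atT big1 ?addr0 => [|A A0]; last first.
  by rewrite m0 ?mul0r // neq0.
rewrite addrCA [RHS]addrC; congr (_ + _).
rewrite (bigD1 [set: _]) //= setCT subseq_at0 subseq_atT big1 => [|A AT]; last first.
  rewrite [X in _ * X]m0 ?mulr0 // neq0 //; apply: contra AT => /eqP A0.
  by rewrite -[A]setCK A0 setC0.
by rewrite /bump /=; ring.
Qed.

(** By [split_termS], the unknown m (r.+1 :: s) has coefficient -(c2 r + 2 theta m [:: 0]); this is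
    where the nonvanishing hypothesis comes from. *)
Lemma leading_loop_equation_unique m m' :
  (forall r, c2 r + 2 * theta * m [:: 0%N] != 0) ->
  leading_loop_equation m -> leading_loop_equation m' ->
  m [:: 0%N] = m' [:: 0%N] ->
  (forall s, s != [::] -> m (0%N :: s) = 0) ->
  (forall s, s != [::] -> m' (0%N :: s) = 0) ->
  forall q s, m (q :: s) = m' (q :: s).
Proof.
move=> nz Lm Lm' mm0 m0 m'0 q s.
have [n] := ubnP (size s); elim: n q s => // n IHn q s /ltnSE size_s.
have [k] := ubnP q; elim: k q => // k IHk [|r] /ltnSE lerk.
  by have [->|s0] := eqVneq s [::]; rewrite // m0 ?m'0.
(* A full A leaves the same list with a smaller first argument, settled by the inner induction; any
   other A gives a shorter list. *)
have sub u (A : {set 'I_(size s)}) : (u <= r)%N ->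
    m (u :: subseq_at A) = m' (u :: subseq_at A).
  move=> leur; have [->|AT] := eqVneq A [set: _].
    by rewrite subseq_atT IHk // (leq_trans _ lerk).
  apply: IHn; rewrite size_subseq_at; apply: leq_trans size_s.
  by rewrite -[X in (_ < X)%N]card_ord -cardsT proper_card // properT.
(* The first argument may grow here, but one argument is lost, and the outer induction holds for
   every first argument. *)
have mrg t : merged_term m t s = merged_term m' t s.
  apply: eq_bigr => i _; congr (_ * _); apply: IHn; apply: leq_trans size_s.
  rewrite size_subseq_at -[X in (_ < X)%N]card_ord -cardsT proper_card //.
  by rewrite properT; apply: contraTneq (in_setT i) => <-; rewrite !inE eqxx.
have spl : split_term m r s = split_term m' r s.
  apply: eq_bigr => u _; apply: eq_bigr => A _.
  have leur : (u <= r)%N by rewrite -ltnS ltn_ord.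
  by rewrite [m (val u :: _)]sub // [m ((r - u)%N :: _)]sub // leq_subr.
have := Lm r s; rewrite -[RHS](Lm' r s) !split_termS // !mrg spl.
rewrite -[s in m (r :: s)]subseq_atT -[s in m' (r :: s)]subseq_atT sub // -mm0.
have -> : \sum_(u < r) \sum_(A : {set 'I_(size s)})
      m (u.+1 :: subseq_at A) * m ((r - u)%N :: subseq_at (~: A)) =
    \sum_(u < r) \sum_(A : {set 'I_(size s)})
      m' (u.+1 :: subseq_at A) * m' ((r - u)%N :: subseq_at (~: A)).
    apply: eq_bigr => u _; apply: eq_bigr => A _.
  by rewrite [m (u.+1 :: _)]sub // [m ((r - u)%N :: _)]sub // leq_subr.
move=> /eqP; rewrite -subr_eq0 => /eqP E; apply: (mulfI (nz r)).
apply/eqP; rewrite -subr_eq0 -oppr_eq0; apply/eqP; rewrite -[RHS]E.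
ring.
Qed.

End LoopUniqueness.

From mathcomp Require Import measurable_realfun.
From mathcomp Require Import all_classical all_reals all_analysis.
Import numFieldNormedType.Exports.
Import RatFun3Theory.

(** * Integration over the cube *)

Definition tcons (T : Type) (n : nat) (p : T * n.-tuple T) : n.+1.-tuple T :=
  [tuple of p.1 :: p.2].

Section CubeMeasure.
Local Open Scope classical_set_scope.
Variable R : realType.
Local Notation mR := (measurableTypeR R).

Lemma measurable_tcons n :
  measurable_fun [set: mR * n.-tuple mR] (@tcons mR n).
Proof. exact: measurable_cons. Qed.

HB.instance Definition _ n := isMeasurableFun.Build _ _ _ _ (@tcons mR n)
  (@measurable_tcons n).

Definition unit_prob : probability mR R := uniform_prob (@ltr01 R).

(** The product measure follows the recursion of [cube_integral]. Being a probability, it makes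
    every bounded measurable function integrable. *)
Fixpoint cube_prob (n : nat) : probability (n.-tuple mR) R :=
  match n with
  | 0 => \d_([tuple] : 0.-tuple mR)
  | n'.+1 => distribution (unit_prob \x cube_prob n')%E (@tcons mR n')
  end.

Definition clamp (x : R) : R := Num.max 0 (Num.min x 1).

Lemma clamp_ge0 x : 0 <= clamp x.
Proof. by rewrite le_max lexx. Qed.

Lemma clamp_le1 x : clamp x <= 1.
Proof. by rewrite ge_max ler01 ge_min lexx orbT. Qed.

Lemma clampE x : 0 <= x <= 1 -> clamp x = x.
Proof. by case/andP=> x0 x1; rewrite /clamp (min_idPl x1) (max_idPr x0). Qed.

Lemma measurable_clamp : measurable_fun [set: mR] (clamp : mR -> mR).
Proof.
apply: measurable_maxr; first exact: measurable_cst.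
by apply: measurable_minr; [exact: measurable_id | exact: measurable_cst].
Qed.

Definition in_cube n (t : n.-tuple R) : Prop := forall l, 0 <= tnth t l <= 1.

Definition tclamp n (t : n.-tuple R) : n.-tuple R := map_tuple clamp t.

Lemma in_cube_tclamp n (t : n.-tuple R) : in_cube (tclamp t).
Proof. by move=> l; rewrite tnth_map clamp_ge0 clamp_le1. Qed.

Lemma in_cube_tcons n x (t : n.-tuple R) :
  0 <= x <= 1 -> in_cube t -> in_cube (tcons (x, t)).
Proof.
move=> x01 tC l; case: (unliftP ord0 l) => [k ->|->]; last by rewrite tnth0.
by rewrite tnthS.
Qed.

Lemma tclamp_tcons n x (t : n.-tuple R) :
  tclamp (tcons (x, t)) = tcons (clamp x, tclamp t).
Proof. exact: val_inj. Qed.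

Lemma measurable_tclamp n : measurable_fun [set: n.-tuple mR] (@tclamp n : _ -> n.-tuple mR).
Proof.
apply/measurable_fun_tnthP => i.
rewrite (_ : _ \o _ = clamp \o (fun t : n.-tuple mR => tnth t i)); last first.
  by apply/funext => t /=; rewrite tnth_map.
by apply: measurableT_comp; [exact: measurable_clamp | exact: measurable_tnth].
Qed.

(** The bound is uniform over the family: with I = nat this is the domination needed for a limit
    under the integral, and with I = unit it concerns one function. *)
Definition cube_bounded n (I : Type) (g : I -> n.-tuple R -> R) : Prop :=
  (forall i, measurable_fun [set: n.-tuple mR] (g i)) /\
  exists M, forall i t, in_cube t -> `|g i t| <= M.

(* Composing with tclamp turns bounds on the cube into global bounds, so that
   everything is integrable for the probability measure cube_prob. *)
Definition cube_int n (f : n.-tuple R -> R) : R :=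
  (\int[cube_prob n]_t (f (tclamp t)))%R.

Section BoundedFamilies.
Variables (n : nat) (I : Type).
Implicit Types f g : I -> n.-tuple R -> R.

Lemma eq_cube_bounded f g : (forall i t, f i t = g i t) ->
  cube_bounded g -> cube_bounded f.
Proof. by move=> fg; have -> // : f = g by do 2 apply: funext => ?. Qed.

Lemma cube_bounded_cst (c : R) : cube_bounded (fun (_ : I) (_ : n.-tuple R) => c).
Proof. by split=> [i|]; [exact: measurable_cst | exists `|c|]. Qed.

Lemma cube_bounded_tnth l : cube_bounded (fun (_ : I) (t : n.-tuple R) => tnth t l).
Proof.
split=> [i|]; first exact: (@measurable_tnth _ mR).
by exists 1 => i t /(_ l)/andP[t0 t1]; rewrite ger0_norm.
Qed.

Lemma cube_boundedD f g : cube_bounded f -> cube_bounded g ->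
  cube_bounded (fun i t => f i t + g i t).
Proof.
move=> [mf [M fM]] [mg [M' gM']]; split=> [i|]; first exact: measurable_funD.
exists (M + M') => i t tC; rewrite (le_trans (ler_normD _ _)) // lerD //.
  exact: fM.
exact: gM'.
Qed.

Lemma cube_boundedN f : cube_bounded f -> cube_bounded (fun i t => - f i t).
Proof.
move=> [mf [M fM]]; split=> [i|]; first exact: measurableT_comp (mf i).
by exists M => i t tC; rewrite normrN; exact: fM.
Qed.

Lemma cube_boundedB f g : cube_bounded f -> cube_bounded g ->
  cube_bounded (fun i t => f i t - g i t).
Proof. by move=> bf /cube_boundedN; exact: cube_boundedD. Qed.

Lemma cube_boundedM f g : cube_bounded f -> cube_bounded g ->
  cube_bounded (fun i t => f i t * g i t).
Proof.
move=> [mf [M fM]] [mg [M' gM']]; split=> [i|]; first exact: measurable_funM.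
exists (M * M') => i t tC; rewrite normrM ler_pM //; first exact: fM.
exact: gM'.
Qed.

Lemma cube_bounded_sum (J : Type) (r : seq J) (P : pred J)
    (F : J -> I -> n.-tuple R -> R) :
  (forall j, P j -> cube_bounded (F j)) ->
  cube_bounded (fun i t => \sum_(j <- r | P j) F j i t).
Proof.
move=> bF; elim: r => [|j r IHr].
  by apply: eq_cube_bounded (cube_bounded_cst _) => i t; rewrite big_nil.
have [Pj|nPj] := boolP (P j); last first.
  by apply: eq_cube_bounded IHr => i t; rewrite big_cons (negPf nPj).
apply: eq_cube_bounded (_ : cube_bounded (fun i t => F j i t + \sum_(j <- r | P j) F j i t)) => [i t|].
  by rewrite big_cons Pj.
exact: cube_boundedD (bF j Pj) IHr.
Qed.

Lemma cube_bounded_prod (J : Type) (r : seq J) (P : pred J)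
    (F : J -> I -> n.-tuple R -> R) :
  (forall j, P j -> cube_bounded (F j)) ->
  cube_bounded (fun i t => \prod_(j <- r | P j) F j i t).
Proof.
move=> bF; elim: r => [|j r IHr].
  by apply: eq_cube_bounded (cube_bounded_cst _) => i t; rewrite big_nil.
have [Pj|nPj] := boolP (P j); last first.
  by apply: eq_cube_bounded IHr => i t; rewrite big_cons (negPf nPj).
apply: eq_cube_bounded (_ : cube_bounded (fun i t => F j i t * \prod_(j <- r | P j) F j i t)) => [i t|].
  by rewrite big_cons Pj.
exact: cube_boundedM (bF j Pj) IHr.
Qed.

Lemma cube_boundedX f k : cube_bounded f -> cube_bounded (fun i t => f i t ^+ k).
Proof.
move=> bf; elim: k => [|k IHk]; first exact: cube_bounded_cst.
apply: eq_cube_bounded (cube_boundedM bf IHk) => i t; exact: exprS.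
Qed.

Lemma cube_bounded_powR f p : 0 <= p -> (forall i t, in_cube t -> 0 <= f i t) ->
  cube_bounded f -> cube_bounded (fun i t => f i t `^ p).
Proof.
move=> p0 f0 [mf [M fM]]; split=> [i|].
  exact: measurableT_comp (@measurable_powR R p) (mf i).
exists (M `^ p) => i t tC; rewrite ger0_norm ?powR_ge0 //.
have fle : f i t <= M by rewrite (le_trans _ (fM i t tC)) // ler_norm.
by apply: ge0_ler_powR; rewrite ?nnegrE ?f0 // (le_trans _ fle) ?f0.
Qed.

End BoundedFamilies.

End CubeMeasure.

Notation bounded_on_cube f := (cube_bounded (fun _ : unit => f)).

Section CubeIntegral.
Local Open Scope classical_set_scope.
Variable R : realType.
Local Notation mR := (measurableTypeR R).

Lemma integral_unit_prob (f : mR -> \bar R) : measurable_fun [set: mR] f ->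
  (\int[unit_prob R]_x f x = \int[lebesgue_measure]_(x in `[0%R, 1%R]) f x)%E.
Proof.
move=> mf; rewrite integralE [RHS]integralE.
rewrite !integral_uniform ?subr0 ?invr1 ?mul1e //.
- exact: measurable_funeneg.
- exact: measurable_funepos.
Qed.

Lemma cube_bounded_row n (I : Type) (g : I -> n.-tuple R -> R) i :
  cube_bounded g -> bounded_on_cube (g i).
Proof. by move=> [mg [M gM]]; split=> //; exists M => _ t; exact: gM. Qed.

Lemma measurable_clamped n (f : n.-tuple R -> R) : bounded_on_cube f ->
  measurable_fun [set: n.-tuple mR] (fun t => f (tclamp t)).
Proof. by case=> /(_ tt) mf _; exact: measurableT_comp mf (@measurable_tclamp R n). Qed.

Lemma finite_integrable d (T : measurableType d) (P : probability T R) (f : T -> R) M :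
  measurable_fun [set: T] f -> (forall x, `|f x| <= M) ->
  P.-integrable [set: T] (EFin \o f).
Proof.
move=> mf fM; apply: measurable_bounded_integrable => //.
  exact: le_lt_trans (probability_le1 P measurableT) (ltry _).
exists M; split; first exact: num_real.
by move=> x Mx y _; exact: le_trans (fM y) (ltW Mx).
Qed.

Lemma cube_bounded_integrable n (f : n.-tuple R -> R) : bounded_on_cube f ->
  (cube_prob R n).-integrable [set: n.-tuple mR] (EFin \o (fun t => f (tclamp t))).
Proof.
move=> bf; have [_ [M fM]] := bf; apply: finite_integrable.
  exact: measurable_clamped.
by move=> t; apply: (fM tt); exact: in_cube_tclamp.
Qed.

Lemma eq_cube_int n (f g : n.-tuple R -> R) :
  (forall t, in_cube t -> f t = g t) -> cube_int f = cube_int g.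
Proof.
move=> fg; apply: eq_Rintegral => t _; rewrite fg //; exact: in_cube_tclamp.
Qed.

Lemma cube_intD n (f g : n.-tuple R -> R) : bounded_on_cube f -> bounded_on_cube g ->
  cube_int (fun t => f t + g t) = cube_int f + cube_int g.
Proof. by move=> bf bg; apply: RintegralD => //; exact: cube_bounded_integrable. Qed.

Lemma cube_intZ n c (f : n.-tuple R -> R) : bounded_on_cube f ->
  cube_int (fun t => c * f t) = c * cube_int f.
Proof. by move=> bf; apply: RintegralZl => //; exact: cube_bounded_integrable. Qed.

Lemma cube_int_sum n (J : Type) (r : seq J) (P : pred J) (F : J -> n.-tuple R -> R) :
  (forall j, P j -> bounded_on_cube (F j)) ->
  cube_int (fun t => \sum_(j <- r | P j) F j t) = \sum_(j <- r | P j) cube_int (F j).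
Proof.
move=> bF; elim: r => [|j r IHr].
  rewrite big_nil (@eq_cube_int _ _ (fun t => 0 * 0)) => [|t _]; last by rewrite big_nil mulr0.
  by rewrite cube_intZ ?mul0r //; exact: cube_bounded_cst.
rewrite big_cons -IHr; have [Pj|nPj] := boolP (P j); last first.
  by apply: eq_cube_int => t _; rewrite big_cons (negPf nPj).
rewrite -cube_intD; last 2 first.
- exact: bF.
- exact: cube_bounded_sum.
by apply: eq_cube_int => t _; rewrite big_cons Pj.
Qed.

Lemma cube_int_ge0 n (f : n.-tuple R -> R) :
  (forall t, in_cube t -> 0 <= f t) -> 0 <= cube_int f.
Proof. by move=> f0; apply: Rintegral_ge0 => t _; apply: f0; exact: in_cube_tclamp. Qed.

Let fin_int d (T : measurableType d) (P : probability T R) (f : T -> R) M :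
  measurable_fun [set: T] f -> (forall x, `|f x| <= M) ->
  (\int[P]_x (f x)%:E)%E = (\int[P]_x f x)%R%:E.
Proof.
move=> mf fM; rewrite fineK //; apply: integrable_fin_num => //.
exact: (finite_integrable P mf fM).
Qed.

Lemma bounded_on_cube_tcons n (f : n.+1.-tuple R -> R) x : 0 <= x <= 1 ->
  bounded_on_cube f -> bounded_on_cube (fun t => f (tcons (x, t))).
Proof.
move=> x01 [mf [M fM]]; split=> [i|]; last first.
  by exists M => i t tC; apply: (fM tt); exact: in_cube_tcons.
apply: (measurableT_comp (mf tt)).
by apply: measurable_cons; [exact: measurable_cst | exact: measurable_id].
Qed.

Let integral_distribution_bounded d d' (T : measurableType d) (T' : measurableType d')
    (P : probability T R) (h : {mfun T >-> T'}) (f : T' -> R) M :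
  measurable_fun [set: T'] f -> (forall x, `|f x| <= M) ->
  (\int[distribution P h]_y (f y)%:E = \int[P]_x (f (h x))%:E)%E.
Proof.
move=> mf fM; rewrite (@integral_distribution _ _ _ _ _ _ h (EFin \o f)) //.
  exact/measurable_EFinP.
rewrite -[_ \o _]/(EFin \o (fun x => f (h x))).
apply: (@finite_integrable _ _ _ _ M); last by move=> x; exact: fM.
exact: measurableT_comp.
Qed.

Section Cons.
Variables (n : nat) (f : n.+1.-tuple R -> R).
Hypothesis bf : bounded_on_cube f.
Let F (p : mR * n.-tuple mR) := f (tclamp (tcons p)).

Let measurable_F : measurable_fun [set: mR * n.-tuple mR] F.
Proof. exact: measurableT_comp (measurable_clamped bf) (@measurable_tcons R n). Qed.

Let F_bounded : exists M, forall p, `|F p| <= M.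
Proof.
by have [_ [M fM]] := bf; exists M => p; apply: (fM tt); exact: in_cube_tclamp.
Qed.

Let integrable_F :
  (unit_prob R \x cube_prob R n)%E.-integrable [set: mR * n.-tuple mR] (EFin \o F).
Proof.
by have [M FM] := F_bounded; exact: finite_integrable measurable_F FM.
Qed.

Let cube_int_prod :
  (cube_int f)%:E = (\int[unit_prob R \x cube_prob R n]_p (F p)%:E)%E.
Proof.
have [_ [M fM]] := bf.
have fM' t : `|f (tclamp t)| <= M by apply: (fM tt); exact: in_cube_tclamp.
rewrite /cube_int -(fin_int _ (measurable_clamped bf) fM').
exact: (integral_distribution_bounded _ _ (measurable_clamped bf) fM').
Qed.

Let measurable_Fx x : measurable_fun [set: n.-tuple mR] (fun t => F (x, t)).
Proof. exact: measurableT_comp measurable_F (pair1_measurable x). Qed.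

Let fubini_FE :
  fubini_F (cube_prob R n) (EFin \o F) =
  EFin \o (fun x => cube_int (fun t => f (tcons (clamp x, t)))).
Proof.
apply/funext => x; rewrite /fubini_F /cube_int; have [M FM] := F_bounded.
rewrite (fin_int _ (measurable_Fx x) (fun t => FM (x, t))).
by congr _%:E; apply: eq_Rintegral => t _; rewrite /F tclamp_tcons.
Qed.

Lemma cube_int_tcons :
  (cube_int f)%:E =
  (\int[unit_prob R]_x (cube_int (fun t => f (tcons (clamp x, t))))%:E)%E.
Proof. by rewrite cube_int_prod -integral12_prod_meas1 // fubini_FE. Qed.

Lemma measurable_cube_int_tcons :
  measurable_fun [set: mR] (fun x : mR => cube_int (fun t => f (tcons (clamp x, t)))).
Proof.
apply/measurable_EFinP; rewrite -[_ \o _]fubini_FE.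
exact: measurable_fubini_F integrable_F.
Qed.

(** Fubini in the order opposite to [cube_int_tcons]: the head coordinate is integrated
    innermost. *)
Lemma cube_int_swap_eq0 :
  (forall t, in_cube t -> (\int[unit_prob R]_x (f (tcons (clamp x, t)))%:E = 0)%E) ->
  cube_int f = 0.
Proof.
move=> f0; apply: EFin_inj; rewrite cube_int_prod -integral21_prod_meas1 //.
apply: integral0_eq => t _; rewrite /fubini_G.
rewrite -[RHS](f0 (tclamp t)); last exact: in_cube_tclamp.
by apply: eq_integral => x _; rewrite /= /F tclamp_tcons.
Qed.

End Cons.

End CubeIntegral.

Section CubeIntegralTheory.
Local Open Scope classical_set_scope.
Variable R : realType.
Local Notation mR := (measurableTypeR R).

Lemma itv01_clamp (x : R) : x \in (`]0, 1[ : set R) -> 0 <= x <= 1.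
Proof. by rewrite inE /= in_itv /= => /andP[x0 x1]; rewrite !ltW. Qed.

(** The link with the integrals of the statement: [cube_integral] runs over open intervals,
    [unit_prob] over the closed one, and the end points are negligible. *)
Lemma cube_integralE n (f : n.-tuple R -> R) : bounded_on_cube f ->
  cube_integral (fun t => (f t)%:E) = (cube_int f)%:E.
Proof.
elim: n f => [|n IHn] f bf /=.
  rewrite /cube_int /Rintegral /= integral_dirac //; last first.
    by apply/measurable_EFinP; exact: measurable_clamped.
  by rewrite diracT mul1e /=; congr (f _)%:E; exact: val_inj.
rewrite cube_int_tcons // integral_unit_prob; last first.
  by apply/measurable_EFinP; exact: measurable_cube_int_tcons.
rewrite [RHS]integral_itv_bndoo; last first.
  apply: measurable_funTS.
  by apply/measurable_EFinP; exact: measurable_cube_int_tcons.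
apply: eq_integral => x x01; have x01' := itv01_clamp x01.
by rewrite clampE // -IHn //; exact: bounded_on_cube_tcons.
Qed.

Definition tset n (t : n.-tuple R) (j : 'I_n) (x : R) : n.-tuple R :=
  [tuple if i == j then x else tnth t i | i < n].

Lemma in_cube_tset n (t : n.-tuple R) j x :
  0 <= x <= 1 -> in_cube t -> in_cube (tset t j x).
Proof. by move=> x01 tC i; rewrite tnth_mktuple; case: ifP. Qed.

(** Coordinates before j are peeled off as outer integrals until j is the head, which is then
    integrated innermost. *)
Lemma cube_int_tset_eq0 n (g : n.-tuple R -> R) (j : 'I_n) : bounded_on_cube g ->
  (forall t, in_cube t -> (\int[unit_prob R]_x (g (tset t j (clamp x)))%:E = 0)%E) ->
  cube_int g = 0.
Proof.
elim: n g j => [|n IHn] g j bg g0; first by case: (j) => [[]].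
case: (unliftP ord0 j) => [k jE|jE].
  apply: EFin_inj; rewrite cube_int_tcons //; apply: integral0_eq => x _.
  have cx : 0 <= clamp x <= 1 by rewrite clamp_ge0 clamp_le1.
  rewrite (IHn _ k) // => [|t tC]; first exact: bounded_on_cube_tcons.
  rewrite -[RHS](g0 (tcons (clamp x, t))); last exact: in_cube_tcons.
  apply: eq_integral => y _; congr (g _)%:E; apply: eq_from_tnth => i.
  rewrite tnth_mktuple jE; case: (unliftP ord0 i) => [l ->|->] //.
  by rewrite (inj_eq lift_inj) !tnthS tnth_mktuple.
apply: cube_int_swap_eq0 => // t tC.
(* The 0 is a placeholder in the cube, overwritten by [tset]. *)
rewrite -[RHS](g0 (tcons (0, t))); last by apply: in_cube_tcons; rewrite // lexx ler01.
apply: eq_integral => y _; congr (g _)%:E; apply: eq_from_tnth => i.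
rewrite tnth_mktuple jE; case: (unliftP ord0 i) => [l ->|->] //.
by rewrite !tnthS.
Qed.

Lemma cube_int_cvg n (g : nat -> n.-tuple R -> R) (h : n.-tuple R -> R) :
  cube_bounded g -> bounded_on_cube h ->
  (forall t, in_cube t -> g k t @[k --> \oo] --> h t) ->
  cube_int (g k) @[k --> \oo] --> cube_int h.
Proof.
move=> bg bh gh; have [mg [M gM]] := bg.
have mgc k := measurable_clamped (cube_bounded_row k bg).
apply: fine_cvg; rewrite fineK; last first.
  by apply: integrable_fin_num => //; exact: cube_bounded_integrable.
have [] := @dominated_convergence _ _ _ (cube_prob R n) setT measurableT
  (fun k t => (g k (tclamp t))%:E) (fun t => (h (tclamp t))%:E) (fun=> M%:E).
- by move=> k; apply/measurable_EFinP.
- by apply/measurable_EFinP; exact: measurable_clamped.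
- apply: aeW => t _; apply: cvg_EFin; first exact: nearW.
  by apply: gh; exact: in_cube_tclamp.
- by apply: (@finite_integrable _ _ _ _ _ `|M|) => //; exact: measurable_cst.
- apply: aeW => t k _; rewrite lee_fin; apply: gM; exact: in_cube_tclamp.
by [].
Qed.

(** Were the integral zero, h would vanish almost everywhere, and the open unit interval would be
    covered by a null set and the finite set L. *)
Lemma unit_prob_gt0 (h : mR -> R) (L : seq R) :
  measurable_fun [set: mR] h -> (forall x, 0 <= h x) ->
  (forall x, 0 < x < 1 -> x \notin L -> 0 < h x) ->
  (\int[unit_prob R]_x (h x)%:E != 0)%E.
Proof.
move=> mh h0 hL; apply/eqP; rewrite integral_unit_prob; last exact/measurable_EFinP.
move=> E; have : (\int[lebesgue_measure]_(x in `[0%R, 1%R]) `|(h x)%:E| = 0)%E.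
  by rewrite -[RHS]E; apply: eq_integral => x _; rewrite gee0_abs ?lee_fin.
move/ae_eq_integral_abs => [] //.
  by apply: measurable_funTS; exact/measurable_EFinP.
move=> Z [mZ Z0 hZ].
have L0 : lebesgue_measure ([set` L] : set R) = 0%E.
  by apply: countable_lebesgue_measure0; apply: finite_set_countable; exact: finite_seq.
have mL : measurable ([set` L] : set mR).
  apply: countable_measurable; first by move=> x; exact: measurable_set1.
  by apply: finite_set_countable; exact: finite_seq.
have : (lebesgue_measure (`]0%R, 1%R[ : set R) <= 0 :> \bar R)%E.
  apply: (@le_trans _ _ (lebesgue_measure (Z `|` [set` L]))).
    apply: le_measure; rewrite ?inE //; first exact: measurableU.
    move=> x /= /[!in_itv]/= /andP[x0 x1].
    have [xL|xL] := boolP (x \in L); [by right | left].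
    apply: hZ => /= H; have := hL x; rewrite x0 x1 => /(_ isT xL).
    have : (h x)%:E = 0%E by apply: H; rewrite in_itv /= !ltW.
    by case=> ->; rewrite ltxx.
  apply: le_trans (measureU2 _ mZ mL) _.
  by rewrite [X in (X + _)%E]Z0 [X in (_ + X)%E]L0 adde0.
by rewrite lebesgue_measure_itv /= lte_fin ltr01 oppr0 adde0 lee_fin ler10.
Qed.

(* The list L of excluded values carries the induction: it collects the
   coordinates already fixed by the outer integrals. *)
Lemma cube_int_gt0 n (g : n.-tuple R -> R) (L : seq R) : bounded_on_cube g ->
  (forall t, in_cube t -> 0 <= g t) ->
  (forall t : n.-tuple R, uniq t -> (forall l, 0 < tnth t l < 1) ->
     (forall l, tnth t l \notin L) -> 0 < g t) ->
  0 < cube_int g.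
Proof.
elim: n g L => [|n IHn] g L bg g0 gL.
  rewrite -lte_fin -cube_integralE // lte_fin; apply: gL => //; by case.
rewrite lt0r cube_int_ge0 // andbT.
have -> : (cube_int g != 0) = ((cube_int g)%:E != 0%E) by [].
rewrite cube_int_tcons //.
apply: (@unit_prob_gt0 _ L); first exact: measurable_cube_int_tcons.
  move=> x; apply: cube_int_ge0 => t tC; apply: g0; apply: in_cube_tcons => //.
  by rewrite clamp_ge0 clamp_le1.
move=> x x01 xL; have /andP[x0 x1] := x01.
rewrite clampE ?ltW //; apply: (IHn _ (x :: L)) => [|t tC|t ut t01 tL].
- by apply: bounded_on_cube_tcons; rewrite // !ltW.
- by apply: g0; apply: in_cube_tcons; rewrite // !ltW.
apply: gL.
- rewrite /= ut andbT; apply/tnthP => -[i xE].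
  by have := tL i; rewrite -xE mem_head.
- by move=> l; case: (unliftP ord0 l) => [k ->|->]; rewrite ?tnthS ?tnth0.
move=> l; case: (unliftP ord0 l) => [k ->|->]; rewrite ?tnthS ?tnth0 //.
by have := tL k; rewrite inE negb_or => /andP[].
Qed.

End CubeIntegralTheory.

(** * Limits, logarithmic derivatives and integration of a derivative *)

Section RealAnalysis.
Local Open Scope classical_set_scope.
Variable R : realType.

(** At a positive limit the power is differentiable. At 0 it is not treated by derivatives: h x <
    e^(1/p) gives (h x)^p < e. *)
Lemma cvg_powR (T : Type) (F : set_system T) (FF : Filter F) (h : T -> R) (l p : R) :
  0 < p -> (forall x, 0 <= h x) -> 0 <= l ->
  h x @[x --> F] --> l -> h x `^ p @[x --> F] --> l `^ p.
Proof.
move=> p0 h0; rewrite le_eqVlt => /predU1P[<-|l0] hl.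
  rewrite powR0 ?gt_eqF //; apply/cvgr0Pnorm_lt => e e0.
  have e'0 : 0 < e `^ p^-1 by rewrite powR_gt0.
  near=> x; rewrite ger0_norm ?powR_ge0 //.
  have <- : (e `^ p^-1) `^ p = e.
    by rewrite -powRrM mulVf ?gt_eqF // powRr1 // ltW.
  rewrite gt0_ltr_powR ?nnegrE ?powR_ge0 //.
  rewrite -[h x]ger0_norm //; near: x.
  by move/cvgr0Pnorm_lt : hl; apply.
apply: (@cvg_comp _ _ _ h (fun x => powR x p) _ _ _ hl).
have : {for l, continuous (fun x => x `^ p)}.
  apply: differentiable_continuous; apply/derivable1_diffP.
  by have [] := is_derive1_powR p l0.
exact.
Unshelve. all: by end_near. Qed.

Lemma cvg_prod_seq (T : Type) (F : set_system T) (FF : Filter F) (J : Type)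
    (s : seq J) (P : pred J) (f : J -> T -> R) (l : J -> R) :
  (forall i, P i -> f i x @[x --> F] --> l i) ->
  \prod_(i <- s | P i) f i x @[x --> F] --> \prod_(i <- s | P i) l i.
Proof.
move=> fl; elim: s => [|i s IHs].
  by rewrite big_nil; under eq_cvg do rewrite big_nil; exact: cvg_cst.
rewrite big_cons; under eq_cvg do rewrite big_cons; case: ifP => // Pi.
by apply: cvgM => //; exact: fl.
Qed.

Lemma cvg_sum_seq (T : Type) (F : set_system T) (FF : Filter F) (J : Type)
    (s : seq J) (P : pred J) (f : J -> T -> R) (l : J -> R) :
  (forall i, P i -> f i x @[x --> F] --> l i) ->
  \sum_(i <- s | P i) f i x @[x --> F] --> \sum_(i <- s | P i) l i.
Proof.
move=> fl; elim: s => [|i s IHs].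
  by rewrite big_nil; under eq_cvg do rewrite big_nil; exact: cvg_cst.
rewrite big_cons; under eq_cvg do rewrite big_cons; case: ifP => // Pi.
by apply: cvgD => //; exact: fl.
Qed.

Lemma is_derive1D (f g : R -> R) (x df dg : R) :
  is_derive x 1 f df -> is_derive x 1 g dg ->
  is_derive x 1 (fun y => f y + g y) (df + dg).
Proof. by move=> hf hg; exact: is_deriveD. Qed.

Lemma is_derive1M (f g : R -> R) (x df dg : R) :
  is_derive x 1 f df -> is_derive x 1 g dg ->
  is_derive x 1 (fun y => f y * g y) (df * g x + f x * dg).
Proof. by move=> hf hg; apply: is_derive_eq; rewrite addrC mulrC. Qed.

Lemma is_derive1X (f : R -> R) (x df : R) k :
  is_derive x 1 f df -> is_derive x 1 (fun y => f y ^+ k) (k%:R * f x ^+ k.-1 * df).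
Proof. by move=> hf; have := is_deriveX k hf; rewrite exprfctE. Qed.

Lemma is_derive1_sum (I : Type) (r : seq I) (P : pred I) (f : I -> R -> R) (x : R) (df : I -> R) :
  (forall i, P i -> is_derive x 1 (f i) (df i)) ->
  is_derive x 1 (fun y => \sum_(i <- r | P i) f i y) (\sum_(i <- r | P i) df i).
Proof.
move=> hf; elim: r => [|i r IHr].
  rewrite big_nil (_ : (fun _ => _) = cst 0); first exact: is_derive_cst.
  by apply/funext => y; rewrite big_nil.
rewrite big_cons; have [Pi|nPi] := boolP (P i).
  rewrite (_ : (fun _ => _) = fun y => f i y + \sum_(j <- r | P j) f j y).
    by apply: is_derive1D => //; exact: hf.
  by apply/funext => y; rewrite big_cons Pi.
rewrite (_ : (fun _ => _) = fun y => \sum_(j <- r | P j) f j y) //.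
by apply/funext => y; rewrite big_cons (negPf nPi).
Qed.

Lemma is_derive1_prod_set (I : finType) (S : {set I}) (f : I -> R -> R) (x : R) (df : I -> R) :
  (forall i, is_derive x 1 (f i) (df i)) ->
  is_derive x 1 (fun y => \prod_(i in S) f i y)
    (\sum_(i in S) df i * \prod_(j in (S :\ i)%SET) f j x).
Proof.
move=> hf; have [n] := ubnP #|S|; elim: n S => // n IHn S leSn.
have [->|[k kS]] := set_0Vmem S.
  rewrite big_set0 (_ : (fun _ => _) = cst 1); first exact: is_derive_cst.
  by apply/funext => y; rewrite big_set0.
rewrite (_ : (fun _ => _) = fun y => f k y * \prod_(i in (S :\ k)%SET) f i y); last first.
  by apply/funext => y; rewrite (big_setD1 k).
have ltS : (#|(S :\ k)%SET| < n)%N by rewrite (cardsD1 k) kS in leSn.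
apply: is_derive_eq; first exact: is_derive1M (hf k) (IHn _ ltS).
rewrite [RHS](big_setD1 k) //=; congr (_ + _).
rewrite mulr_sumr; apply: eq_bigr => i; rewrite !inE => /andP[ik iS].
rewrite [X in _ = _ * X](big_setD1 k) /=; last by rewrite !inE eq_sym ik.
by rewrite finset.setDDl finset.setUC -finset.setDDl mulrCA.
Qed.

(** Each derivative is given as the function times its logarithmic derivative, so the product needs
    no division. *)
Lemma is_derive1_prod_log (I : Type) (r : seq I) (P : pred I) (f : I -> R -> R) (x : R) (c : I -> R) :
  (forall i, P i -> is_derive x 1 (f i) (f i x * c i)) ->
  is_derive x 1 (fun y => \prod_(i <- r | P i) f i y)
    (\prod_(i <- r | P i) f i x * \sum_(i <- r | P i) c i).
Proof.
move=> hf; elim: r => [|i r IHr].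
  rewrite !big_nil mulr0 (_ : (fun _ => _) = cst 1); first exact: is_derive_cst.
  by apply/funext => y; rewrite big_nil.
rewrite !big_cons; have [Pi|nPi] := boolP (P i).
  rewrite (_ : (fun _ => _) = fun y => f i y * \prod_(j <- r | P j) f j y).
    by apply: is_derive_eq; [exact: is_derive1M (hf i Pi) IHr | rewrite /=; ring].
  by apply/funext => y; rewrite big_cons Pi.
rewrite (_ : (fun _ => _) = fun y => \prod_(j <- r | P j) f j y) //.
by apply/funext => y; rewrite big_cons (negPf nPi).
Qed.

Lemma is_derive1_powR_comp (f : R -> R) (x df p : R) : 0 < f x ->
  is_derive x 1 f df ->
  is_derive x 1 (fun y => f y `^ p) (f x `^ p * (p * df / f x)).
Proof.
move=> f0 hf.
have H : is_derive x 1 ((fun y => y `^ p) \o f) (p * f x `^ (p - 1) * df).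
  exact: is_derive1_comp (is_derive1_powR p f0) hf.
apply: is_derive_eq.
by rewrite powRB ?powRr1 ?ltW ?(gt_eqF f0) ?implybT //; ring.
Qed.

Lemma clamp_continuous : continuous (@clamp R).
Proof.
move=> x; apply: (@continuous_max _ _ (fun=> 0) (fun y : R => Num.min y 1) x).
  exact: cvg_cst.
by apply: (@continuous_min _ _ id (fun=> 1) x); [exact: cvg_id | exact: cvg_cst].
Qed.

(** The fundamental theorem of calculus. Differentiability is asked only inside the interval, where
    the powers of x and 1 - x have positive bases; composing with [clamp] expresses continuity up to
    the end points. *)
Lemma integral_unit_prob_derive (F f : R -> R) :
  (forall x : R, 0 < x < 1 -> is_derive x 1 F (f x)) ->
  continuous (F \o @clamp R) -> continuous (f \o @clamp R) ->
  F 0 = 0 -> F 1 = 0 ->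
  (\int[unit_prob R]_x (f (clamp x))%:E = 0)%E.
Proof.
move=> dF cF cf F0 F1.
rewrite integral_unit_prob; last first.
  apply/measurable_EFinP; exact: continuous_measurable_fun.
have c0 : clamp (0 : R) = 0 by rewrite clampE // lexx ler01.
have c1 : clamp (1 : R) = 1 by rewrite clampE // lexx ler01.
have nclamp (x : R) : 0 < x < 1 -> \forall y \near x, clamp y = y.
  move=> /andP[x0 x1]; near=> y; rewrite clampE //; apply/andP; split; apply: ltW.
    by near: y; exact: lt_nbhsr.
  by near: y; exact: lt_nbhsl.
have dFc (x : R) : 0 < x < 1 -> is_derive x 1 (F \o @clamp R) (f x).
  move=> x01; have [dx <-] := dF x x01.
  apply: near_eq_is_derive (DeriveDef dx erefl).
  near=> y; rewrite /=; congr (F _); apply/esym; near: y; exact: nclamp.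
rewrite (@continuous_FTC2 _ (f \o @clamp R) (F \o @clamp R) 0 1) //=.
- by rewrite c0 c1 F0 F1 subee.
- exact: continuous_subspaceT.
- split; first by move=> x /[!in_itv]/= /dFc[].
    by apply: cvg_at_right_filter; exact: cF.
  by apply: cvg_at_left_filter; exact: cF.
move=> x /[!in_itv]/= x01; rewrite derive1E; have [_ ->] := dFc x x01.
by rewrite /= clampE //; case/andP: x01 => x0 x1; rewrite !ltW.
Unshelve. all: by end_near. Qed.

End RealAnalysis.

(** * Continuity on the cube *)

Section PathContinuity.
Local Open Scope classical_set_scope.
Variables (R : realType) (n : nat).
Implicit Types f g : n.-tuple R -> R.

(* Continuity tested along filtered families, which avoids putting a topology on
   tuples. *)
Definition path_continuous f : Prop :=
  forall (F : set_system R) (gamma : R -> n.-tuple R) (t : n.-tuple R), Filter F ->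
  (forall u, in_cube (gamma u)) -> in_cube t ->
  (forall l, tnth (gamma u) l @[u --> F] --> tnth t l) ->
  f (gamma u) @[u --> F] --> f t.

Lemma path_continuous_cst c : path_continuous (fun=> c).
Proof. by move=> F gamma t FF _ _ _; exact: cvg_cst. Qed.

Lemma path_continuous_tnth l : path_continuous (fun t => tnth t l).
Proof. by move=> F gamma t FF _ _; exact. Qed.

Lemma path_continuousD f g : path_continuous f -> path_continuous g ->
  path_continuous (fun t => f t + g t).
Proof. by move=> cf cg F gamma t FF gC tC gt; apply: cvgD; [exact: cf | exact: cg]. Qed.

Lemma path_continuousN f : path_continuous f -> path_continuous (fun t => - f t).
Proof. by move=> cf F gamma t FF gC tC gt; apply: cvgN; exact: cf. Qed.

Lemma path_continuousB f g : path_continuous f -> path_continuous g ->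
  path_continuous (fun t => f t - g t).
Proof. by move=> cf /path_continuousN; exact: path_continuousD. Qed.

Lemma path_continuousM f g : path_continuous f -> path_continuous g ->
  path_continuous (fun t => f t * g t).
Proof. by move=> cf cg F gamma t FF gC tC gt; apply: cvgM; [exact: cf | exact: cg]. Qed.

Lemma path_continuous_sum (J : Type) (r : seq J) (P : pred J)
    (f : J -> n.-tuple R -> R) : (forall j, P j -> path_continuous (f j)) ->
  path_continuous (fun t => \sum_(j <- r | P j) f j t).
Proof.
move=> cf F gamma t FF gC tC gt.
by apply: (@cvg_sum_seq _ _ _ _ _ _ _ (fun j u => f j (gamma u))) => j Pj; exact: cf.
Qed.

Lemma path_continuous_prod (J : Type) (r : seq J) (P : pred J)
    (f : J -> n.-tuple R -> R) : (forall j, P j -> path_continuous (f j)) ->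
  path_continuous (fun t => \prod_(j <- r | P j) f j t).
Proof.
move=> cf F gamma t FF gC tC gt.
by apply: (@cvg_prod_seq _ _ _ _ _ _ _ (fun j u => f j (gamma u))) => j Pj; exact: cf.
Qed.

Lemma path_continuousX f k : path_continuous f -> path_continuous (fun t => f t ^+ k).
Proof.
move=> cf; elim: k => [|k IHk]; first exact: path_continuous_cst.
have -> : (fun t => f t ^+ k.+1) = fun t => f t * f t ^+ k.
  by apply/funext => t; rewrite exprS.
exact: path_continuousM.
Qed.

Lemma path_continuousV f : (forall t, in_cube t -> f t != 0) ->
  path_continuous f -> path_continuous (fun t => (f t)^-1).
Proof.
by move=> f0 cf F gamma t FF gC tC gt; apply: cvgV; [exact: f0 | exact: cf].
Qed.

Lemma path_continuous_powR f p : 0 < p -> (forall t, in_cube t -> 0 <= f t) ->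
  path_continuous f -> path_continuous (fun t => f t `^ p).
Proof.
move=> p0 f0 cf F gamma t FF gC tC gt; apply: cvg_powR => //.
- by move=> u; exact: f0.
- exact: f0.
exact: cf.
Qed.

Lemma path_continuous_tset f t j : in_cube t -> path_continuous f ->
  continuous ((fun x => f (tset t j x)) \o @clamp R).
Proof.
move=> tC cf x; apply: cf => [u||l].
- by apply: in_cube_tset; rewrite ?clamp_ge0 ?clamp_le1.
- by apply: in_cube_tset; rewrite ?clamp_ge0 ?clamp_le1.
rewrite tnth_mktuple; under eq_cvg do rewrite tnth_mktuple.
by case: ifP => _; [exact: clamp_continuous | exact: cvg_cst].
Qed.

Lemma cube_boundedV (I : Type) (f : I -> n.-tuple R -> R) c : 0 < c ->
  (forall i t, c <= f i t) -> cube_bounded f -> cube_bounded (fun i t => (f i t)^-1).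
Proof.
move=> c0 cf [mf _]; split=> [i|].
  have fP t : (f i t)^-1 = f i t `^ (-1).
    by rewrite powR_inv1 // (le_trans (ltW c0)).
  rewrite (_ : (fun _ => _) = (fun x => x `^ (-1)) \o f i); last first.
    by apply/funext => t; exact: fP.
  exact: measurableT_comp (@measurable_powR R (-1)) (mf i).
exists c^-1 => i t _; rewrite ger0_norm ?invr_ge0 ?(le_trans (ltW c0)) //.
by rewrite lef_pV2 ?posrE // (lt_le_trans c0).
Qed.

End PathContinuity.

(** * Loop equations of the Jacobi ensemble *)

Section RegularizedLoop.
Local Open Scope classical_set_scope.
Variables (R : realType) (N : nat) (A B kappa : R).
Hypotheses (A_gt0 : 0 < A) (B_gt0 : 0 < B) (kappa_gt0 : 0 < kappa).
Variables (I : finType) (p : I -> nat) (r : nat).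
Implicit Types (t : N.-tuple R) (S : {set I}) (j : 'I_N) (delta : R).

Definition weight_prod t : R := \prod_(l < N) weightJs A B (tnth t l).

(* For 2 kappa < 1 the factors |t_b - t_a|^(2 kappa) are not differentiable at 0;
   they are replaced by ((t_b - t_a)^2 + delta)^kappa with delta > 0. *)
Definition reg_vandermonde delta t : R :=
  \prod_(a < N) \prod_(b < N | (a < b)%N)
    ((tnth t b - tnth t a) ^+ 2 + delta) `^ kappa.

Definition power_sum_prod S t : R := \prod_(i in S) power_sum (p i) t.

(* the logarithmic derivative of reg_vandermonde with respect to t_j *)
Definition reg_dlog delta j t : R :=
  \sum_(a < N) \sum_(b < N | (a < b)%N)
    kappa * (2 * (tnth t b - tnth t a) * ((b == j)%:R - (a == j)%:R)) /
    ((tnth t b - tnth t a) ^+ 2 + delta).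

Definition loop_field delta S j t : R :=
  (tnth t j ^+ r.+1 * (1 - tnth t j) * weight_prod t) *
  (power_sum_prod S t * reg_vandermonde delta t).

(** The singular logarithmic derivatives A / t_j and -B / (1 - t_j) of the weight are already
    cancelled against t_j^(r+1) (1 - t_j), which yields the coefficients r + 1 + A and r + 2 + A +
    B. *)
Definition loop_field_deriv delta S j t : R :=
  weight_prod t * reg_vandermonde delta t *
  (((r.+1%:R + A) * tnth t j ^+ r - (r.+2%:R + A + B) * tnth t j ^+ r.+1) *
     power_sum_prod S t +
   tnth t j ^+ r.+1 * (1 - tnth t j) *
   (\sum_(i in S) (p i)%:R * tnth t j ^+ (p i).-1 * power_sum_prod (S :\ i)%SET t +
    power_sum_prod S t * reg_dlog delta j t)).

Section Derivative.
Variables (t : N.-tuple R) (j : 'I_N) (x : R).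
Hypothesis x01 : 0 < x < 1.
Let T y := tset t j y.

Let Tj y : tnth (T y) j = y.
Proof. by rewrite tnth_mktuple eqxx. Qed.

Lemma is_derive_tset i : is_derive x 1 (fun y => tnth (T y) i) (i == j)%:R.
Proof.
under eq_fun do rewrite tnth_mktuple.
by case: eqP => _; [exact: is_derive_id | exact: is_derive_cst].
Qed.

Lemma is_derive_power_sum q :
  is_derive x 1 (fun y => power_sum q (T y)) (q%:R * x ^+ q.-1).
Proof.
have := is_derive1_sum (index_enum _) (P := xpredT)
  (fun i _ => is_derive1X q (is_derive_tset i)).
move/is_derive_eq; apply; rewrite (bigD1 j) //= Tj eqxx mulr1 big1 ?addr0 // => i.
by move=> /negPf->; rewrite mulr0.
Qed.

Lemma is_derive_power_sum_prod S :
  is_derive x 1 (fun y => power_sum_prod S (T y))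
    (\sum_(i in S) (p i)%:R * x ^+ (p i).-1 * power_sum_prod (S :\ i)%SET (T x)).
Proof. by apply: is_derive1_prod_set => i; exact: is_derive_power_sum. Qed.

Lemma is_derive_reg_vandermonde delta : 0 < delta ->
  is_derive x 1 (fun y => reg_vandermonde delta (T y))
    (reg_vandermonde delta (T x) * reg_dlog delta j (T x)).
Proof.
move=> d0; apply: is_derive1_prod_log => a _; apply: is_derive1_prod_log => b _.
apply: is_derive1_powR_comp; first by rewrite ltr_wpDl ?sqr_ge0.
have dba : is_derive x 1 (fun y => tnth (T y) b - tnth (T y) a)
    ((b == j)%:R - (a == j)%:R).
  by apply: is_deriveB; exact: is_derive_tset.
have := is_derive1D (is_derive1X 2 dba) (is_derive_cst delta x 1).
by move/is_derive_eq; apply; rewrite addr0 expr1.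
Qed.

Lemma is_derive_weighted :
  is_derive x 1
    (fun y => tnth (T y) j ^+ r.+1 * (1 - tnth (T y) j) * weight_prod (T y))
    (weight_prod (T x) *
       ((r.+1%:R + A) * x ^+ r - (r.+2%:R + A + B) * x ^+ r.+1)).
Proof.
have [x0 x1] := andP x01.
pose C := \prod_(l < N | l != j) weightJs A B (tnth t l).
have WE y : weight_prod (T y) = y `^ A * (1 - y) `^ B * C.
  rewrite /weight_prod (bigD1 j) //= Tj; congr (_ * _); apply: eq_bigr => l.
  by move=> /negPf lj; rewrite tnth_mktuple lj.
under eq_fun do rewrite Tj WE.
have d1 : is_derive x 1 (fun y : R => 1 - y) (-1).
  by have := is_deriveB (is_derive_cst (1 : R) x 1) (is_derive_id x 1); rewrite sub0r.
have dA := is_derive1_powR_comp A x0 (is_derive_id x 1).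
have x1' : 0 < 1 - x by rewrite subr_gt0.
have dB := @is_derive1_powR_comp R (fun y => 1 - y) x _ B x1' d1.
have := is_derive1M (is_derive1M (is_derive1X r.+1 (is_derive_id x 1)) d1)
  (is_derive1M (is_derive1M dA dB) (is_derive_cst C x 1)).
move/is_derive_eq; apply; rewrite WE /= exprS -[r.+2]addn1 -[r.+1]addn1 !natrD.
have xn0 := lt0r_neq0 x0; have xn1 := lt0r_neq0 x1'.
by field; rewrite xn0 xn1.
Qed.

Lemma is_derive_loop_field delta S : 0 < delta ->
  is_derive x 1 (fun y => loop_field delta S j (T y)) (loop_field_deriv delta S j (T x)).
Proof.
move=> d0; have := is_derive1M is_derive_weighted
  (is_derive1M (is_derive_power_sum_prod S) (is_derive_reg_vandermonde d0)).
by move/is_derive_eq; apply; rewrite /loop_field_deriv Tj; ring.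
Qed.

End Derivative.

Section Bounds.
Variable J : Type.

Lemma weight_prod_bounded : cube_bounded (fun (_ : J) t => weight_prod t).
Proof.
apply: cube_bounded_prod => l _; apply: cube_boundedM.
  apply: cube_bounded_powR; [exact: ltW | | exact: cube_bounded_tnth].
  by move=> _ t /(_ l)/andP[].
apply: cube_bounded_powR; first exact: ltW.
  by move=> _ t /(_ l)/andP[_ t1]; rewrite subr_ge0.
by apply: cube_boundedB; [exact: cube_bounded_cst | exact: cube_bounded_tnth].
Qed.

Lemma reg_vandermonde_bounded (delta : J -> R) : (forall i, 0 <= delta i <= 1) ->
  cube_bounded (fun i t => reg_vandermonde (delta i) t).
Proof.
move=> d01; apply: cube_bounded_prod => a _; apply: cube_bounded_prod => b _.
have bdelta : cube_bounded (fun (i : J) t => delta i).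
  split=> [i|]; first exact: measurable_cst.
  by exists 1 => i t _; have /andP[d0 d1] := d01 i; rewrite ger0_norm.
apply: cube_bounded_powR => [|i t _|]; first exact: ltW.
  by have /andP[d0 _] := d01 i; rewrite addr_ge0 ?sqr_ge0.
by apply: cube_boundedD => //; apply: cube_boundedX; apply: cube_boundedB;
  exact: cube_bounded_tnth.
Qed.

Lemma power_sum_bounded q : cube_bounded (fun (_ : J) t => power_sum q t).
Proof.
by apply: cube_bounded_sum => l _; apply: cube_boundedX; exact: cube_bounded_tnth.
Qed.

Lemma power_sum_prod_bounded S : cube_bounded (fun (_ : J) t => power_sum_prod S t).
Proof. by apply: cube_bounded_prod => i _; exact: power_sum_bounded. Qed.

Lemma reg_dlog_bounded delta j : 0 < delta ->
  cube_bounded (fun (_ : J) t => reg_dlog delta j t).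
Proof.
move=> d0; apply: cube_bounded_sum => a _; apply: cube_bounded_sum => b _.
have bba : cube_bounded (fun (_ : J) t => tnth t b - tnth t a).
  by apply: cube_boundedB; exact: cube_bounded_tnth.
apply: cube_boundedM.
  apply: cube_boundedM; first exact: cube_bounded_cst.
  apply: cube_boundedM; last exact: cube_bounded_cst.
  by apply: cube_boundedM => //; exact: cube_bounded_cst.
apply: (@cube_boundedV _ _ _ _ delta) => // [i t|].
  by rewrite lerDr sqr_ge0.
by apply: cube_boundedD; [exact: cube_boundedX | exact: cube_bounded_cst].
Qed.

End Bounds.

Lemma weight_prod_path_continuous : path_continuous weight_prod.
Proof.
apply: path_continuous_prod => l _; apply: path_continuousM.
  apply: path_continuous_powR; [by [] | | exact: path_continuous_tnth].
  by move=> t /(_ l)/andP[].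
apply: path_continuous_powR; first by [].
  by move=> t /(_ l)/andP[_ t1]; rewrite subr_ge0.
by apply: path_continuousB; [exact: path_continuous_cst | exact: path_continuous_tnth].
Qed.

Let diff_path_continuous a b : path_continuous (fun t => tnth t b - tnth t a).
Proof. by apply: path_continuousB; exact: path_continuous_tnth. Qed.

Lemma reg_vandermonde_path_continuous delta : 0 <= delta ->
  path_continuous (reg_vandermonde delta).
Proof.
move=> d0; apply: path_continuous_prod => a _; apply: path_continuous_prod => b _.
apply: path_continuous_powR => [|t _|]; first by [].
  by rewrite addr_ge0 ?sqr_ge0.
apply: path_continuousD; last exact: path_continuous_cst.
exact: path_continuousX.
Qed.

Lemma power_sum_prod_path_continuous S : path_continuous (power_sum_prod S).
Proof.
apply: path_continuous_prod => i _; apply: path_continuous_sum => l _.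
by apply: path_continuousX; exact: path_continuous_tnth.
Qed.

Lemma reg_dlog_path_continuous delta j : 0 < delta ->
  path_continuous (reg_dlog delta j).
Proof.
move=> d0; apply: path_continuous_sum => a _; apply: path_continuous_sum => b _.
apply: path_continuousM.
  apply: path_continuousM; first exact: path_continuous_cst.
  apply: path_continuousM; last exact: path_continuous_cst.
  by apply: path_continuousM => //; exact: path_continuous_cst.
apply: path_continuousV => [t _|].
  by rewrite gt_eqF // ltr_wpDl ?sqr_ge0.
apply: path_continuousD; last exact: path_continuous_cst.
exact: path_continuousX.
Qed.

Let tj_path_continuous j q : path_continuous (fun t => tnth t j ^+ q).
Proof. by apply: path_continuousX; exact: path_continuous_tnth. Qed.

Lemma loop_field_path_continuous delta S j : 0 < delta ->
  path_continuous (loop_field delta S j).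
Proof.
move=> d0; apply: path_continuousM; apply: path_continuousM.
- apply: path_continuousM => //; apply: path_continuousB.
    exact: path_continuous_cst.
  exact: path_continuous_tnth.
- exact: weight_prod_path_continuous.
- exact: power_sum_prod_path_continuous.
by apply: reg_vandermonde_path_continuous; exact: ltW.
Qed.

Lemma loop_field_deriv_path_continuous delta S j : 0 < delta ->
  path_continuous (loop_field_deriv delta S j).
Proof.
move=> d0; have cG S' : path_continuous (power_sum_prod S').
  exact: power_sum_prod_path_continuous.
apply: path_continuousM.
  apply: path_continuousM; first exact: weight_prod_path_continuous.
  by apply: reg_vandermonde_path_continuous; exact: ltW.
apply: path_continuousD; apply: path_continuousM => //.
- by apply: path_continuousB; apply: path_continuousM => //; exact: path_continuous_cst.
- apply: path_continuousM => //; apply: path_continuousB.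
    exact: path_continuous_cst.
  exact: path_continuous_tnth.
apply: path_continuousD.
  apply: path_continuous_sum => i _; apply: path_continuousM => //.
  by apply: path_continuousM => //; exact: path_continuous_cst.
by apply: path_continuousM => //; exact: reg_dlog_path_continuous.
Qed.

Lemma loop_field_deriv_bounded delta S j : 0 < delta <= 1 ->
  bounded_on_cube (loop_field_deriv delta S j).
Proof.
move=> /andP[d0 d1]; have bG S' : bounded_on_cube (power_sum_prod S').
  exact: power_sum_prod_bounded.
have btj q : cube_bounded (fun (_ : unit) t => tnth t j ^+ q).
  by apply: cube_boundedX; exact: cube_bounded_tnth.
apply: cube_boundedM.
  apply: cube_boundedM; first exact: weight_prod_bounded.
  by apply: reg_vandermonde_bounded => _; rewrite ltW.
apply: cube_boundedD; apply: cube_boundedM => //.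
- by apply: cube_boundedB; apply: cube_boundedM => //; exact: cube_bounded_cst.
- apply: cube_boundedM => //; apply: cube_boundedB.
    exact: cube_bounded_cst.
  exact: cube_bounded_tnth.
apply: cube_boundedD.
  apply: cube_bounded_sum => i _; apply: cube_boundedM => //.
  by apply: cube_boundedM => //; exact: cube_bounded_cst.
by apply: cube_boundedM => //; exact: reg_dlog_bounded.
Qed.

(** No boundary term arises: t_j^(r+1) vanishes at 0 and 1 - t_j at 1. *)
Lemma cube_int_loop_field_deriv delta S j : 0 < delta <= 1 ->
  cube_int (loop_field_deriv delta S j) = 0.
Proof.
move=> d01; have /andP[d0 d1] := d01.
apply: (@cube_int_tset_eq0 _ _ _ j); first exact: loop_field_deriv_bounded.
move=> t tC; apply: (@integral_unit_prob_derive _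
  (fun x => loop_field delta S j (tset t j x))
  (fun x => loop_field_deriv delta S j (tset t j x))).
- by move=> x x01; exact: is_derive_loop_field.
- by apply: path_continuous_tset tC _; exact: loop_field_path_continuous.
- by apply: path_continuous_tset tC _; exact: loop_field_deriv_path_continuous.
- by rewrite /loop_field tnth_mktuple eqxx expr0n !mul0r.
by rewrite /loop_field tnth_mktuple eqxx subrr mulr0 !mul0r.
Qed.

End RegularizedLoop.

(** * Divided differences of powers *)

Section DividedDifference.
Variable K : comNzRingType.

(** The quotient of x^(m+1) - y^(m+1) by x - y, written as a polynomial so that it makes sense on
    the diagonal. *)
Definition divdiff (m : nat) (x y : K) : K := \sum_(u < m.+1) x ^+ u * y ^+ (m - u).

Lemma divdiffE m x y : x ^+ m.+1 - y ^+ m.+1 = (x - y) * divdiff m x y.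
Proof.
rewrite subrXX /divdiff (reindex_inj rev_ord_inj) /=; congr (_ * _).
by apply: eq_bigr => u _; rewrite subSS subKn // -ltnS.
Qed.

Lemma divdiff_sym m x y : divdiff m x y = divdiff m y x.
Proof.
rewrite /divdiff (reindex_inj rev_ord_inj) /=; apply: eq_bigr => u _.
by rewrite subSS subKn 1?mulrC // -ltnS.
Qed.

Lemma divdiff_diag m x : divdiff m x x = m.+1%:R * x ^+ m.
Proof.
rewrite /divdiff -[m.+1 in RHS]card_ord mulr_natl -sumr_const.
by apply: eq_bigr => u _; rewrite -exprD subnKC // -ltnS.
Qed.

Lemma sum_pairs_sym n (q : 'I_n -> 'I_n -> K) : (forall a b, q a b = q b a) ->
  \sum_(a < n) \sum_(b < n) q a b =
  \sum_(a < n) q a a + \sum_(a < n) \sum_(b < n | (a < b)%N) 2 * q b a.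
Proof.
move=> qC.
have -> : \sum_(a < n) \sum_(b < n | (a < b)%N) 2 * q b a =
    \sum_(a < n) \sum_(b < n | (a < b)%N) q a b +
    \sum_(a < n) \sum_(b < n | (b < a)%N) q a b.
  rewrite [X in _ = _ + X](exchange_big_dep xpredT) //= -big_split /=.
  apply: eq_bigr => a _; rewrite -big_split /=; apply: eq_bigr => b _.
  by rewrite (qC a b) mulr2n mulrDl mul1r.
rewrite -!big_split /=; apply: eq_bigr => a _.
rewrite (bigD1 a) //=; congr (_ + _); rewrite (bigID (fun b : 'I_n => (a < b)%N)) /=.
congr (_ + _); apply: eq_bigl => b.
  by case: ltngtP => //; rewrite ?andbF ?andbT // => ltab; rewrite -val_eqE /= gt_eqF.
rewrite -leqNgt -val_eqE /=; case: ltngtP => //.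
Qed.

End DividedDifference.

(** * Removal of the regularization and the moment equations *)

Section LoopLimit.
Local Open Scope classical_set_scope.
Variables (R : realType) (N : nat) (A B kappa : R).
Hypotheses (A_gt0 : 0 < A) (B_gt0 : 0 < B) (kappa_gt0 : 0 < kappa).
Variables (I : finType) (p : I -> nat) (r : nat).
Implicit Types (t : N.-tuple R) (S : {set I}) (j : 'I_N) (delta : R).

Local Notation W := (@weight_prod R N A B).
Local Notation V := (@reg_vandermonde R N kappa).
Local Notation G := (@power_sum_prod R N I p).

(** The divided difference of x^(r+1) (1 - x). *)
Let dd (x y : R) := divdiff r x y - divdiff r.+1 x y.

Let lin S t : R :=
  ((r.+1%:R + A) * power_sum r t - (r.+2%:R + A + B) * power_sum r.+1 t) * G S t +
  \sum_(i in S) (p i)%:R *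
    (power_sum (r + p i) t - power_sum (r.+1 + p i) t) * G (S :\ i)%SET t.

Let ratio delta t a b : R :=
  (tnth t b - tnth t a) ^+ 2 / ((tnth t b - tnth t a) ^+ 2 + delta).

(* Summing the integrands over j pairs up the singular terms into divided
   differences, multiplied by a ratio bounded by 1 uniformly in delta. *)
Definition reg_loop delta S t : R :=
  W t * (V delta t * lin S t + G S t *
    \sum_(a < N) \sum_(b < N | (a < b)%N)
      kappa * (2 * dd (tnth t b) (tnth t a)) * (V delta t * ratio delta t a b)).

Definition lim_loop S t : R :=
  W t * (V 0 t * lin S t + G S t *
    \sum_(a < N) \sum_(b < N | (a < b)%N)
      kappa * (2 * dd (tnth t b) (tnth t a)) * V 0 t).

Lemma ddE x y : x ^+ r.+1 * (1 - x) - y ^+ r.+1 * (1 - y) = (x - y) * dd x y.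
Proof.
rewrite /dd [RHS]mulrBr -!divdiffE !exprS; ring.
Qed.

(** For a pair a < b only j = a and j = b contribute, with opposite signs. The difference of t^(r+1)
    (1 - t) at the two points supplies a second factor t_b - t_a, which turns the singular quotient
    into [ratio]. *)
Lemma sum_loop_field_deriv delta S t :
  \sum_(j < N) loop_field_deriv A B kappa p r delta S j t = reg_loop delta S t.
Proof.
rewrite /loop_field_deriv -mulr_sumr /reg_loop -mulrA; congr (_ * _).
rewrite big_split /= -mulr_suml.
under [X in _ * (_ + X)]eq_bigr do rewrite mulrDr.
rewrite [X in _ * (_ + X)]big_split /=.
have -> : \sum_(j < N) ((r.+1%:R + A) * tnth t j ^+ r -
    (r.+2%:R + A + B) * tnth t j ^+ r.+1) =
    (r.+1%:R + A) * power_sum r t - (r.+2%:R + A + B) * power_sum r.+1 t.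
  by rewrite sumrB -!mulr_sumr.
have -> : \sum_(j < N) tnth t j ^+ r.+1 * (1 - tnth t j) *
    (\sum_(i in S) (p i)%:R * tnth t j ^+ (p i).-1 * G (S :\ i)%SET t) =
    \sum_(i in S) (p i)%:R *
    (power_sum (r + p i) t - power_sum (r.+1 + p i) t) * G (S :\ i)%SET t.
  under eq_bigr do rewrite mulr_sumr.
  rewrite exchange_big /=; apply: eq_bigr => i _; rewrite -sumrB mulr_sumr mulr_suml.
  (* For exponent 0 the truncated predecessor is harmless, because the coefficient is 0. *)
  apply: eq_bigr => j _; case: (p i) => [|k]; first by rewrite !mul0r mulr0.
  by rewrite /= addSn addnS !exprS !exprD; ring.
have -> : \sum_(j < N) tnth t j ^+ r.+1 * (1 - tnth t j) *
    (G S t * reg_dlog kappa delta j t) = G S t *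
    \sum_(a < N) \sum_(b < N | (a < b)%N)
      kappa * (2 * dd (tnth t b) (tnth t a)) * ratio delta t a b.
  under eq_bigr do rewrite mulrCA.
  rewrite -mulr_sumr; congr (_ * _); rewrite /reg_dlog.
  under eq_bigr do rewrite mulr_sumr.
  rewrite exchange_big /=; apply: eq_bigr => a _.
  under eq_bigr do rewrite mulr_sumr.
  rewrite exchange_big /=; apply: eq_bigr => b ltab.
  have nba : (b == a) = false by rewrite -val_eqE /= gtn_eqF.
  rewrite (bigD1 a) // (bigD1 b) /=; last by rewrite nba.
  rewrite big1 ?addr0 => [|j /andP[ja jb]]; last first.
    by rewrite [b == j]eq_sym [a == j]eq_sym (negPf ja) (negPf jb) subrr !(mulr0, mul0r).
  rewrite !eqxx [a == b]eq_sym nba /ratio.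
  have := ddE (tnth t b) (tnth t a).
  set fb := _ * (1 - tnth t b); set fa := _ * (1 - tnth t a) => E.
  rewrite (_ : kappa * (2 * _) * _ = kappa * 2 * (tnth t b - tnth t a) *
     ((tnth t b - tnth t a) * dd (tnth t b) (tnth t a)) /
     ((tnth t b - tnth t a) ^+ 2 + delta)); last by ring.
  by rewrite -E /= ?mulr0n ?mulr1n ?sub0r ?subr0 ?mulr1 ?mulrN1; ring.
have -> : \sum_(a < N) \sum_(b < N | (a < b)%N)
      kappa * (2 * dd (tnth t b) (tnth t a)) * (V delta t * ratio delta t a b) =
    V delta t * \sum_(a < N) \sum_(b < N | (a < b)%N)
      kappa * (2 * dd (tnth t b) (tnth t a)) * ratio delta t a b.
  rewrite mulr_sumr; apply: eq_bigr => a _; rewrite mulr_sumr.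
  by apply: eq_bigr => b _; rewrite mulrCA.
by rewrite /lin; ring.
Qed.

Let delta_ (k : nat) : R := k.+1%:R^-1.

Let delta01 k : 0 < delta_ k <= 1.
Proof. by rewrite /delta_ invr_gt0 ltr0n /= invf_le1 ?ltr0n // ler1n. Qed.

Lemma cube_int_reg_loop k S : cube_int (reg_loop (delta_ k) S) = 0.
Proof.
rewrite -(@eq_cube_int _ _ (fun t => \sum_(j < N) loop_field_deriv A B kappa p r (delta_ k) S j t)).
  rewrite cube_int_sum => [|j _]; last exact: loop_field_deriv_bounded.
  by rewrite big1 // => j _; exact: cube_int_loop_field_deriv.
by move=> t _; exact: sum_loop_field_deriv.
Qed.

Let dd_bounded (J : Type) a b :
  cube_bounded (fun (_ : J) t => dd (tnth t b) (tnth t a)).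
Proof.
by apply: cube_boundedB; apply: cube_bounded_sum => u _; apply: cube_boundedM;
  apply: cube_boundedX; exact: cube_bounded_tnth.
Qed.

Let lin_bounded (J : Type) S : cube_bounded (fun (_ : J) t => lin S t).
Proof.
have bP q : cube_bounded (fun (_ : J) t => power_sum q t) by exact: power_sum_bounded.
have bG S' : cube_bounded (fun (_ : J) t => G S' t) by exact: power_sum_prod_bounded.
apply: cube_boundedD.
  apply: cube_boundedM => //.
  by apply: cube_boundedB; apply: cube_boundedM => //; exact: cube_bounded_cst.
apply: cube_bounded_sum => i _; apply: cube_boundedM => //.
by apply: cube_boundedM; [exact: cube_bounded_cst | exact: cube_boundedB].
Qed.

Let ratio_bounded a b : cube_bounded (fun k t => ratio (delta_ k) t a b).
Proof.
have bba : bounded_on_cube (fun t => tnth t b - tnth t a).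
  by apply: cube_boundedB; exact: cube_bounded_tnth.
split=> [k|].
  have /andP[d0 _] := delta01 k.
  (* Used for measurability only: the bound obtained this way depends on k. *)
  have [mr _] : bounded_on_cube (fun t => ratio (delta_ k) t a b).
    apply: cube_boundedM; first exact: cube_boundedX.
    apply: (@cube_boundedV _ _ _ _ (delta_ k)) => // [_ t|].
      by rewrite lerDr sqr_ge0.
    by apply: cube_boundedD; [exact: cube_boundedX | exact: cube_bounded_cst].
  exact: mr tt.
exists 1 => k t _; rewrite /ratio; have /andP[d0 _] := delta01 k.
have u0 : 0 <= (tnth t b - tnth t a) ^+ 2 by exact: sqr_ge0.
rewrite ger0_norm; last by rewrite divr_ge0 // addr_ge0 // ltW.
by rewrite ler_pdivrMr ?mul1r; [rewrite lerDl ltW | rewrite ltr_wpDl].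
Qed.

Let V_bounded (J : Type) (d : J -> R) : (forall i, 0 <= d i <= 1) ->
  cube_bounded (fun i t => V (d i) t).
Proof. exact: reg_vandermonde_bounded. Qed.

Let reg_loop_bounded S : cube_bounded (fun k t => reg_loop (delta_ k) S t).
Proof.
have bV : cube_bounded (fun k t => V (delta_ k) t).
  by apply: V_bounded => k; have /andP[/ltW-> ->] := delta01 k.
apply: cube_boundedM; first exact: weight_prod_bounded.
apply: cube_boundedD; apply: cube_boundedM => //.
  exact: power_sum_prod_bounded.
apply: cube_bounded_sum => a _; apply: cube_bounded_sum => b _.
apply: cube_boundedM; last exact: cube_boundedM.
apply: cube_boundedM; first exact: cube_bounded_cst.
by apply: cube_boundedM => //; exact: cube_bounded_cst.
Qed.

Let lim_loop_bounded S : bounded_on_cube (lim_loop S).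
Proof.
have bV : bounded_on_cube (V 0) by apply: V_bounded => _; rewrite lexx ler01.
apply: cube_boundedM; first exact: weight_prod_bounded.
apply: cube_boundedD; apply: cube_boundedM => //.
  exact: power_sum_prod_bounded.
apply: cube_bounded_sum => a _; apply: cube_bounded_sum => b _.
apply: cube_boundedM => //.
apply: cube_boundedM; first exact: cube_bounded_cst.
by apply: cube_boundedM => //; exact: cube_bounded_cst.
Qed.

Let delta_cvg0 : delta_ k @[k --> \oo] --> 0.
Proof. exact: cvg_harmonic. Qed.

Let V_cvg t : V (delta_ k) t @[k --> \oo] --> V 0 t.
Proof.
apply: cvg_prod_seq => a _; apply: cvg_prod_seq => b _; apply: cvg_powR => //.
- by move=> k; have /andP[/ltW d0 _] := delta01 k; rewrite addr_ge0 ?sqr_ge0.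
- by rewrite addr_ge0 ?sqr_ge0.
by apply: cvgD; [exact: cvg_cst | exact: delta_cvg0].
Qed.

Let reg_loop_cvg S t : reg_loop (delta_ k) S t @[k --> \oo] --> lim_loop S t.
Proof.
apply: cvgM; first exact: cvg_cst.
apply: cvgD; apply: cvgM; try exact: cvg_cst; first exact: V_cvg.
apply: cvg_sum_seq => a _; apply: cvg_sum_seq => b ltab.
apply: cvgM; first exact: cvg_cst.
have [u0|u0] := eqVneq ((tnth t b - tnth t a) ^+ 2) 0.
  (* the ratio is 0 for every delta, and so is the limiting Vandermonde factor *)
  have -> : V 0 t = 0.
    rewrite /reg_vandermonde (bigD1 a) //= (bigD1 b) //= u0 addr0 powR0 ?mul0r //.
    by rewrite gt_eqF.
  under eq_cvg do rewrite /ratio u0 mul0r mulr0.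
  exact: cvg_cst.
rewrite -[X in _ --> X]mulr1; apply: cvgM; first exact: V_cvg.
rewrite -(divff u0); apply: cvgM; first exact: cvg_cst.
apply: cvgV => //; rewrite -[X in _ --> X]addr0.
by apply: cvgD; [exact: cvg_cst | exact: delta_cvg0].
Qed.

Lemma cube_int_lim_loop S : cube_int (lim_loop S) = 0.
Proof.
have gh t : in_cube t -> reg_loop (delta_ k) S t @[k --> \oo] --> lim_loop S t.
  by move=> _; exact: reg_loop_cvg.
have := cube_int_cvg (reg_loop_bounded S) (lim_loop_bounded S) gh.
under eq_cvg do rewrite cube_int_reg_loop.
by move=> /(cvg_lim (@Rhausdorff R)) <-; rewrite lim_cst.
Qed.

Local Notation rho := (ensemble_density (weightJs A B) kappa (N := N)).
Local Notation E := (ensemble_mean (weightJs A B) kappa (N := N)).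

Lemma densityE t : rho t = W t * V 0 t.
Proof.
congr (_ * _); apply: eq_bigr => a _; apply: eq_bigr => b _.
by rewrite addr0 powRrM powR_mulrn ?normr_ge0 // real_normK // num_real.
Qed.

Lemma density_bounded : bounded_on_cube rho.
Proof.
apply: (eq_cube_bounded (g := fun _ t => W t * V 0 t)) => [_ t|]; first exact: densityE.
apply: cube_boundedM; first exact: weight_prod_bounded.
by apply: V_bounded => _; rewrite lexx ler01.
Qed.

Lemma density_int_gt0 : 0 < cube_int rho.
Proof.
apply: (@cube_int_gt0 _ _ _ [::]) => [|t tC|t ut t01 _]; first exact: density_bounded.
  apply: mulr_ge0; last by do 2 apply: prodr_ge0 => ? _; exact: powR_ge0.
  by apply: prodr_ge0 => l _; rewrite mulr_ge0 ?powR_ge0.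
apply: mulr_gt0; apply: prodr_gt0 => l _.
  by have /andP[t0 t1] := t01 l; rewrite mulr_gt0 ?powR_gt0 ?subr_gt0.
apply: prodr_gt0 => k ltlk; rewrite powR_gt0 // normr_gt0 subr_eq0.
apply: contraTneq ltlk => /(elimT (tuple_uniqP t) ut) ->.
by rewrite ltnn.
Qed.

Lemma meanE (f : N.-tuple R -> R) : bounded_on_cube f ->
  E f = cube_int (fun t => rho t * f t) / cube_int rho.
Proof.
move=> bf; rewrite /ensemble_mean !cube_integralE /=; first last.
- exact: density_bounded.
- by apply: cube_boundedM => //; exact: density_bounded.
by congr (cube_int _ / _); apply/funext => t; rewrite mulrC.
Qed.

Lemma mean1 : E (fun=> 1) = 1.
Proof.
rewrite meanE; last exact: cube_bounded_cst.
rewrite (_ : (fun t => rho t * 1) = rho); last by apply/funext => t; rewrite mulr1.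
by rewrite divff // gt_eqF // density_int_gt0.
Qed.

Lemma meanD f g : bounded_on_cube f -> bounded_on_cube g ->
  E (fun t => f t + g t) = E f + E g.
Proof.
move=> bf bg; rewrite !meanE //; last exact: cube_boundedD.
rewrite -mulrDl -cube_intD; try by apply: cube_boundedM => //; exact: density_bounded.
by congr (cube_int _ / _); apply/funext => t; rewrite mulrDr.
Qed.

Lemma meanZ c f : bounded_on_cube f -> E (fun t => c * f t) = c * E f.
Proof.
move=> bf; rewrite !meanE //; last by apply: cube_boundedM => //; exact: cube_bounded_cst.
rewrite mulrA -cube_intZ; last by apply: cube_boundedM => //; exact: density_bounded.
by congr (cube_int _ / _); apply/funext => t; rewrite mulrCA.
Qed.

Lemma meanB f g : bounded_on_cube f -> bounded_on_cube g ->
  E (fun t => f t - g t) = E f - E g.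
Proof.
move=> bf bg; rewrite -mulN1r -meanZ // -meanD //; last first.
  by apply: cube_boundedM => //; exact: cube_bounded_cst.
by congr E; apply/funext => t; rewrite mulN1r.
Qed.

Lemma mean_sum (J : Type) (s : seq J) (P : pred J) (F : J -> N.-tuple R -> R) :
  (forall k, P k -> bounded_on_cube (F k)) ->
  E (fun t => \sum_(k <- s | P k) F k t) = \sum_(k <- s | P k) E (F k).
Proof.
move=> bF; rewrite meanE; last exact: cube_bounded_sum.
rewrite (_ : (fun _ => _) = fun t => \sum_(k <- s | P k) rho t * F k t); last first.
  by apply/funext => t; rewrite mulr_sumr.
rewrite cube_int_sum => [|k Pk]; last first.
  by apply: cube_boundedM; [exact: density_bounded | exact: bF].
by rewrite mulr_suml; apply: eq_bigr => k Pk; rewrite meanE //; exact: bF.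
Qed.

(** By symmetry the sum over pairs is the full double sum, which factors into power sums, minus its
    diagonal, where the divided difference is (m + 1) x^m. *)
Lemma sum_divdiff m t :
  \sum_(a < N) \sum_(b < N | (a < b)%N) 2 * divdiff m (tnth t b) (tnth t a) =
  \sum_(u < m.+1) power_sum u t * power_sum (m - u) t - m.+1%:R * power_sum m t.
Proof.
have := @sum_pairs_sym _ N (fun a b => divdiff m (tnth t a) (tnth t b)) (fun a b => divdiff_sym _ _ _).
rewrite addrC => /eqP; rewrite -subr_eq => /eqP <-; congr (_ - _).
  rewrite /divdiff; under eq_bigr do rewrite exchange_big /=.
  rewrite exchange_big /=; apply: eq_bigr => u _.
  rewrite mulr_suml; apply: eq_bigr => a _; rewrite mulr_sumr.
  by apply: eq_bigr => b _.
by rewrite mulr_sumr; apply: eq_bigr => a _; rewrite divdiff_diag.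
Qed.

(** In the coefficients 1 - kappa, the 1 comes from differentiating t^(r+1) (1 - t) and the -kappa
    from the diagonal terms in [sum_divdiff]. *)
Lemma moment_loop_equation S :
  let P := fun q t => power_sum q t in
  ((1 - kappa) * r.+1%:R + A) * E (fun t => P r t * G S t) -
  ((1 - kappa) * r.+2%:R + (A + B)) * E (fun t => P r.+1 t * G S t) +
  kappa * (\sum_(u < r.+1) E (fun t => P u t * P (r - u)%N t * G S t) -
           \sum_(u < r.+2) E (fun t => P u t * P (r.+1 - u)%N t * G S t)) +
  (\sum_(i in S) (p i)%:R * E (fun t => P (r + p i)%N t * G (S :\ i)%SET t) -
   \sum_(i in S) (p i)%:R * E (fun t => P (r.+1 + p i)%N t * G (S :\ i)%SET t)) = 0.
Proof.
move=> P.
have bP q : bounded_on_cube (P q) by exact: power_sum_bounded.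
have bG S' : bounded_on_cube (G S') by exact: power_sum_prod_bounded.
have bPG q S' : bounded_on_cube (fun t => P q t * G S' t) by exact: cube_boundedM.
have bPPG q q' : bounded_on_cube (fun t => P q t * P q' t * G S t).
  by apply: cube_boundedM => //; exact: cube_boundedM.
have bc c (f : N.-tuple R -> R) : bounded_on_cube f -> bounded_on_cube (fun t => c * f t).
  by move=> bf; apply: cube_boundedM => //; exact: cube_bounded_cst.
pose lhs t := ((1 - kappa) * r.+1%:R + A) * (P r t * G S t) -
  ((1 - kappa) * r.+2%:R + (A + B)) * (P r.+1 t * G S t) +
  kappa * (\sum_(u < r.+1) P u t * P (r - u)%N t * G S t -
           \sum_(u < r.+2) P u t * P (r.+1 - u)%N t * G S t) +
  (\sum_(i in S) (p i)%:R * (P (r + p i)%N t * G (S :\ i)%SET t) -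
   \sum_(i in S) (p i)%:R * (P (r.+1 + p i)%N t * G (S :\ i)%SET t)).
have limE t : lim_loop S t = rho t * lhs t.
  rewrite densityE /lim_loop -mulrA; congr (_ * _).
  have -> : \sum_(a < N) \sum_(b < N | (a < b)%N)
      kappa * (2 * dd (tnth t b) (tnth t a)) * V 0 t =
    V 0 t * (kappa *
      (\sum_(a < N) \sum_(b < N | (a < b)%N) 2 * divdiff r (tnth t b) (tnth t a) -
       \sum_(a < N) \sum_(b < N | (a < b)%N) 2 * divdiff r.+1 (tnth t b) (tnth t a))).
    rewrite -sumrB !mulr_sumr; apply: eq_bigr => a _; rewrite -sumrB !mulr_sumr.
    by apply: eq_bigr => b _; rewrite /dd; ring.
  rewrite !sum_divdiff /lhs /lin -!mulr_suml -sumrB.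
  have -> : \sum_(i in S) (p i)%:R *
      (power_sum (r + p i) t - power_sum (r.+1 + p i) t) * G (S :\ i)%SET t =
    \sum_(i in S) ((p i)%:R * (P (r + p i)%N t * G (S :\ i)%SET t) -
      (p i)%:R * (P (r.+1 + p i)%N t * G (S :\ i)%SET t)).
    by apply: eq_bigr => i _; rewrite /P; ring.
  by rewrite /P; ring.
have blhs : bounded_on_cube lhs.
  apply: cube_boundedD; last by apply: cube_boundedB; apply: cube_bounded_sum => i _; exact: bc.
  apply: cube_boundedD; first by apply: cube_boundedB; exact: bc.
  by apply: bc; apply: cube_boundedB; exact: cube_bounded_sum.
have E0 : E lhs = 0.
  rewrite meanE //; rewrite -(eq_cube_int (fun t _ => limE t)).
  by rewrite cube_int_lim_loop mul0r.
rewrite -[RHS]E0 /lhs meanD; last 2 first.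
- apply: cube_boundedD; first by apply: cube_boundedB; exact: bc.
  by apply: bc; apply: cube_boundedB; exact: cube_bounded_sum.
- by apply: cube_boundedB; apply: cube_bounded_sum => i _; exact: bc.
rewrite meanD; last 2 first.
- by apply: cube_boundedB; exact: bc.
- by apply: bc; apply: cube_boundedB; exact: cube_bounded_sum.
rewrite meanB ?meanZ //; try exact: bc; last first.
  by apply: cube_boundedB; exact: cube_bounded_sum.
rewrite !meanB; try exact: cube_bounded_sum; try by apply: cube_bounded_sum => i _; exact: bc.
rewrite !mean_sum //; try by move=> i _; exact: bc.
by congr (_ + (_ - _)); apply: eq_bigr => i _; rewrite meanZ.
Qed.

End LoopLimit.

(** * Limits of the loop equations *)

Section ScaledLoop.
Variables (K : fieldType) (c c' : seq nat -> K) (g eps : K).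
Hypothesis cE : forall s, c s = g * eps ^+ size s * c' s.

Lemma joined_term_scaled m s :
  joined_term c m s = g * eps ^+ (size s).+2 * joined_term c' m s.
Proof. by rewrite /joined_term mulr_sumr; apply: eq_bigr => u _; rewrite cE. Qed.

Lemma split_term_scaled m s :
  split_term c m s = g ^+ 2 * eps ^+ (size s).+2 * split_term c' m s.
Proof.
rewrite /split_term mulr_sumr; apply: eq_bigr => u _.
rewrite mulr_sumr; apply: eq_bigr => A _; rewrite !cE /= !size_subseq_at.
have -> : (size s).+2 = (#|A|.+1 + #|(~: A)%SET|.+1)%N.
  by rewrite addSn addnS cardsC card_ord.
by rewrite exprD; ring.
Qed.

Lemma merged_term_scaled m s :
  merged_term c m s = g * eps ^+ size s * merged_term c' m s.
Proof.
rewrite /merged_term mulr_sumr; apply: eq_bigr => i _; rewrite cE /= size_subseq_at.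
have -> : #|[set~ i]%SET|.+1 = size s.
  by rewrite cardsC1 card_ord prednK // (leq_ltn_trans _ (ltn_ord i)).
by ring.
Qed.

(** Joint and split terms have equally many arguments, but a split term has two cumulant factors;
    the extra g is what separates them in the limit. *)
Lemma loop_equation_scaled (c1 c2 kappa : K) r s : g != 0 -> eps != 0 ->
  c1 * c (r :: s) - c2 * c (r.+1 :: s) +
  kappa * (joined_term c r s + split_term c r s -
           (joined_term c r.+1 s + split_term c r.+1 s)) +
  (merged_term c r s - merged_term c r.+1 s) = 0 ->
  eps * c1 * c' (r :: s) - eps * c2 * c' (r.+1 :: s) +
  (kappa * eps ^+ 2 * (joined_term c' r s - joined_term c' r.+1 s) +
   kappa * g * eps ^+ 2 * (split_term c' r s - split_term c' r.+1 s)) +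
  (merged_term c' r s - merged_term c' r.+1 s) = 0.
Proof.
move=> g0 e0; rewrite !joined_term_scaled !split_term_scaled !merged_term_scaled.
rewrite !cE /= => E; apply: (mulfI (mulf_neq0 g0 (expf_neq0 (size s) e0))).
by rewrite mulr0 -[RHS]E !exprS; ring.
Qed.

End ScaledLoop.

Lemma nth_leq_sumn (s : seq nat) i : (nth 0 s i <= sumn s)%N.
Proof.
elim: s i => [|a s IHs] [|i] //=; first exact: leq_addr.
exact: leq_trans (IHs i) (leq_addl _ _).
Qed.

Section LimitLoop.
Local Open Scope classical_set_scope.
Variables (R : realType) (T : Type) (F : set_system T).
Hypothesis FF : ProperFilter F.
Variables (c : T -> seq nat -> R) (y : seq nat -> R).
Variables (c1 c2 k1 k2 : T -> R) (l1 l2 theta : R) (r : nat) (s : seq nat).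

(* a finite superset of the arguments occurring in the loop equation *)
Definition loop_indices : seq (seq nat) :=
  [seq u :: subseq_at A | u <- iota 0 (r + sumn s).+2,
     A <- enum {set 'I_(size s)}] ++
  [seq [:: u, v & s] | u <- iota 0 r.+2, v <- iota 0 r.+2].

(** The bound leaves room for the first arguments r + 1 + s_i of the merged terms. *)
Lemma mem_loop_indices1 u (A : {set 'I_(size s)}) : (u < (r + sumn s).+2)%N ->
  u :: subseq_at A \in loop_indices.
Proof.
move=> ltu; rewrite mem_cat; apply/orP; left; apply/allpairsP.
by exists (u, A); rewrite mem_iota mem_enum.
Qed.

Lemma mem_loop_indices2 u v : (u < r.+2)%N -> (v < r.+2)%N ->
  [:: u, v & s] \in loop_indices.
Proof.
move=> ltu ltv; rewrite mem_cat; apply/orP; right; apply/allpairsP.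
by exists (u, v); rewrite !mem_iota.
Qed.

Hypothesis cy : forall s', s' \in loop_indices -> c t s' @[t --> F] --> y s'.
Hypotheses (c1l : c1 t @[t --> F] --> l1) (c2l : c2 t @[t --> F] --> l2).
Hypotheses (k10 : k1 t @[t --> F] --> 0) (k2l : k2 t @[t --> F] --> theta).

Let joined_cvg m : (m <= r.+1)%N ->
  joined_term (c t) m s @[t --> F] --> joined_term y m s.
Proof.
move=> lem; apply: cvg_sum_seq => u _; apply: cy; apply: mem_loop_indices2.
  by rewrite (leq_trans (ltn_ord u)).
by rewrite ltnS (leq_trans (leq_subr _ _)).
Qed.

Let split_cvg m : (m <= r.+1)%N ->
  split_term (c t) m s @[t --> F] --> split_term y m s.
Proof.
move=> lem; apply: cvg_sum_seq => u _; apply: cvg_sum_seq => A _.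
have le2 : (r.+2 <= (r + sumn s).+2)%N by rewrite !ltnS leq_addr.
apply: cvgM; apply: cy; apply: mem_loop_indices1; apply: leq_trans le2.
  by rewrite (leq_trans (ltn_ord u)).
by rewrite ltnS (leq_trans (leq_subr _ _)).
Qed.

Let merged_cvg m : (m <= r.+1)%N ->
  merged_term (c t) m s @[t --> F] --> merged_term y m s.
Proof.
move=> lem; apply: cvg_sum_seq => i _; apply: cvgM; first exact: cvg_cst.
apply: cy; apply: mem_loop_indices1; rewrite !ltnS -addSn leq_add //.
exact: nth_leq_sumn.
Qed.

Lemma limit_loop_equation :
  (\forall t \near F,
    c1 t * c t (r :: s) - c2 t * c t (r.+1 :: s) +
    (k1 t * (joined_term (c t) r s - joined_term (c t) r.+1 s) +
     k2 t * (split_term (c t) r s - split_term (c t) r.+1 s)) +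
    (merged_term (c t) r s - merged_term (c t) r.+1 s) = 0) ->
  l1 * y (r :: s) - l2 * y (r.+1 :: s) +
  theta * (split_term y r s - split_term y r.+1 s) +
  (merged_term y r s - merged_term y r.+1 s) = 0.
Proof.
move=> loop.
set f := (X in \forall t \near F, X t = 0) in loop.
have fl : f t @[t --> F] --> l1 * y (r :: s) - l2 * y (r.+1 :: s) +
    (0 * (joined_term y r s - joined_term y r.+1 s) +
     theta * (split_term y r s - split_term y r.+1 s)) +
    (merged_term y r s - merged_term y r.+1 s).
  have yT q : (q <= r.+1)%N -> c t (q :: s) @[t --> F] --> y (q :: s).
    move=> leq; rewrite -[s]subseq_atT; apply: cy; apply: mem_loop_indices1.
    by rewrite ltnS (leq_trans leq) // ltnS leq_addr.
  apply: cvgD; last by apply: cvgB; exact: merged_cvg.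
  apply: cvgD; first by apply: cvgB; apply: cvgM => //; exact: yT.
  apply: cvgD; apply: cvgM => //; apply: cvgB; try exact: joined_cvg; exact: split_cvg.
have f0 : f t @[t --> F] --> 0.
  exact: cvg_near_cst loop.
have := cvg_unique (@Rhausdorff R) fl f0.
by rewrite mul0r add0r; apply; exact: fmap_proper_filter.
Qed.

End LimitLoop.

Section EnsembleLoop.
Local Open Scope classical_set_scope.
Variables (R : realType) (N : nat) (A B kappa : R).
Hypotheses (A_gt0 : 0 < A) (B_gt0 : 0 < B) (kappa_gt0 : 0 < kappa).

Definition ensemble_cumulant (w : R -> R) (k : R) (n : nat) : seq nat -> R :=
  cumulant_seq (@ensemble_mean R w k n) (fun q t => power_sum q t).

Lemma mixed_cumulantE w k n s :
  mixed_cumulant w k n (in_tuple s) = ensemble_cumulant w k n s.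
Proof.
congr joint_cumulant; apply/funext => i; apply/funext => t.
by rewrite (tnth_nth 0%N).
Qed.

Lemma ensemble_loop_equation r s :
  let c := ensemble_cumulant (weightJs A B) kappa N in
  ((1 - kappa) * r.+1%:R + A) * c (r :: s) -
  ((1 - kappa) * r.+2%:R + (A + B)) * c (r.+1 :: s) +
  kappa * (joined_term c r s + split_term c r s -
           (joined_term c r.+1 s + split_term c r.+1 s)) +
  (merged_term c r s - merged_term c r.+1 s) = 0.
Proof.
apply: loop_equation_cumulant_seq; first exact: mean1.
by move=> S; exact: moment_loop_equation.
Qed.

Lemma ensemble_cumulant0 s :
  ensemble_cumulant (weightJs A B) kappa N (0%N :: s) = N%:R * (s == [::])%:R.
Proof.
apply: cumulant_seq_const => [|S]; first exact: mean1.
rewrite -meanZ //; last first.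
  by apply: cube_bounded_prod => i _; exact: power_sum_bounded.
congr ensemble_mean; apply/funext => t; congr (_ * _).
rewrite /power_sum; under eq_bigr do rewrite expr0.
by rewrite sumr_const card_ord.
Qed.

End EnsembleLoop.

(** * From equations at points to identities of rational functions *)

Section RationalLoop.
Local Open Scope classical_set_scope.
Variables (R : realType) (m : seq nat -> ratfun3 R).
Variables (c1 c2 : nat -> ratfun3 R) (theta : ratfun3 R).
Variables (v1 v2 : nat -> R -> R -> R) (vtheta : R -> R).
Hypothesis v1P : forall r N a b, ratfun3_value (c1 r) N a b (v1 r a b).
Hypothesis v2P : forall r N a b, ratfun3_value (c2 r) N a b (v2 r a b).
Hypothesis vthetaP : forall N a b, ratfun3_value theta N a b (vtheta N).
Variables (A1 A2 A3 : R -> Prop).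
Hypotheses (A1i : infinite_pred A1) (A2i : infinite_pred A2) (A3i : infinite_pred A3).

(** A given equation involves finitely many coefficients, all regular off one proper algebraic
    subset. There the left side has value 0, and [generically_eq0] concludes. *)
Lemma rational_loop_equation :
  (forall r s N a b y, A1 N -> A2 a -> A3 b ->
    (forall s', s' \in loop_indices r s -> ratfun3_value (m s') N a b (y s')) ->
    v1 r a b * y (r :: s) - v2 r a b * y (r.+1 :: s) +
    vtheta N * (split_term y r s - split_term y r.+1 s) +
    (merged_term y r s - merged_term y r.+1 s) = 0) ->
  leading_loop_equation c1 c2 theta m.
Proof.
move=> loop r s; apply: (generically_eq0 A1i A2i A3i).
have [D D0 DP] := generically_all (loop_indices r s)
  (fun s' => generically_regular (m s')).
exists D => // N a b /DP reg AN Aa Ab.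
(* The default 0 is never met on [loop_indices], where all coefficients are regular. *)
pose y s' := xget 0 [set x | ratfun3_value (m s') N a b x].
have yP s' : s' \in loop_indices r s -> ratfun3_value (m s') N a b (y s').
  by move=> /reg[x mx]; apply: (@xgetPex _ 0 [set x | ratfun3_value (m s') N a b x]); exists x.
rewrite -(loop r s N a b y AN Aa Ab yP).
have val1 u (B : {set 'I_(size s)}) : (u < r.+2)%N ->
    ratfun3_value (m (u :: subseq_at B)) N a b (y (u :: subseq_at B)).
  move=> ltu; apply: yP; apply: mem_loop_indices1; apply: leq_trans ltu _.
  by rewrite !ltnS leq_addr.
have valT u : (u < r.+2)%N -> ratfun3_value (m (u :: s)) N a b (y (u :: s)).
  by move=> ltu; rewrite -[s]subseq_atT; exact: val1.
have vsplit k : (k <= r.+1)%N ->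
    ratfun3_value (split_term m k s) N a b (split_term y k s).
  move=> lek; apply: ratfun3_value_sum => u _; apply: ratfun3_value_sum => B _.
  apply: ratfun3_valueM; apply: val1; first exact: leq_trans (ltn_ord u) _.
  by rewrite ltnS (leq_trans (leq_subr _ _)).
have vmerged k : (k <= r.+1)%N ->
    ratfun3_value (merged_term m k s) N a b (merged_term y k s).
  move=> lek; apply: ratfun3_value_sum => i _.
  apply: ratfun3_valueM; first exact: ratfun3_value_nat.
  apply: yP; apply: mem_loop_indices1; rewrite !ltnS -addSn leq_add //.
  exact: nth_leq_sumn.
apply: ratfun3_valueD; last by apply: ratfun3_valueB; exact: vmerged.
apply: ratfun3_valueD; first by apply: ratfun3_valueB; apply: ratfun3_valueM => //; exact: valT.
by apply: ratfun3_valueM => //; apply: ratfun3_valueB; exact: vsplit.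
Qed.

End RationalLoop.

(** * The low and high temperature limits *)

Section Limits.
Local Open Scope classical_set_scope.
Variable R : realType.

Definition positive_nat (x : R) : Prop := exists2 n, (0 < n)%N & x = n%:R.

Lemma infinite_positive_nat : infinite_pred positive_nat.
Proof.
move=> s; pose l : seq R := [seq i%:R | i <- iota 1 (size s).+1].
have ul : uniq l.
  by rewrite map_inj_uniq ?iota_uniq // => i j /eqP; rewrite eqr_nat => /eqP.
have : ~~ all (mem s) l.
  apply/negP => /allP ls; have := uniq_leq_size ul ls.
  by rewrite size_map size_iota ltnn.
move=> /allPn[_ /mapP[i + ->] nis]; rewrite mem_iota => /andP[i0 _].
by exists i%:R => //; exists i.
Qed.

Lemma infinite_positive : infinite_pred (fun x : R => 0 < x).
Proof.
move=> s; have [_ [n n0 ->] ns] := infinite_positive_nat s.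
by exists n%:R; rewrite // ltr0n.
Qed.

(** Indexing by lists puts coefficients with different numbers of arguments into one family, as the
    recursion requires. *)
Definition seq_family (mu : forall n : nat, n.-tuple nat -> ratfun3 R)
  (s : seq nat) : ratfun3 R := mu (size s) (in_tuple s).

Lemma loop_indices_gt0 r s s' : s' \in loop_indices r s -> (0 < size s')%N.
Proof.
by rewrite mem_cat => /orP[] /allpairsP[[u v] [_ _ ->]].
Qed.

Lemma invr_pinfty_cvg0 : x^-1 @[x --> +oo] --> (0 : R).
Proof.
apply/(@gtr0_cvgV0 _ _ _ _ id); last exact: cvg_id.
exact: nbhs_pinfty_gt.
Qed.

Lemma invr_nat_cvg0 : n%:R^-1 @[n --> \oo] --> (0 : R).
Proof.
apply/(@gtr0_cvgV0 _ _ _ _ (fun n => n%:R)); last exact: cvgr_idn.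
by exists 1%N => // n /= n0; rewrite ltr0n.
Qed.

Let near_pinfty_cvg (f g : R -> R) (l : R) : (forall k : R, 0 < k -> f k = g k) ->
  g k @[k --> +oo] --> l -> f k @[k --> +oo] --> l.
Proof.
move=> fg; apply: cvg_trans; apply: near_eq_cvg.
by have : \forall k \near +oo, (0 : R) < k := nbhs_pinfty_gt (num_real 0); apply: filterS => k /fg ->.
Qed.

Let value_r k N a b : ratfun3_value (k%:R : ratfun3 R) N a b k%:R.
Proof. exact: ratfun3_value_nat. Qed.

Section LowTemperature.
Variable muJ : forall n : nat, n.-tuple nat -> ratfun3 R.
Hypothesis muJ_def : low_temperature_coefficients muJ.

Let muJ_cvg s N a b y : (0 < size s)%N -> (0 < N)%N -> 0 < a -> 0 < b ->
  ratfun3_value (seq_family muJ s) N%:R a b y ->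
  kappa ^+ (size s).-1 * ensemble_cumulant (weightJ kappa a b) kappa N s
    @[kappa --> +oo] --> y.
Proof.
move=> s0 N0 a0 b0 /(muJ_def s0 N0 a0 b0).
by under eq_cvg do rewrite mixed_cumulantE.
Qed.

Lemma low_temperature_loop :
  leading_loop_equation (fun r => ratfun3_a R - r.+1%:R)
    (fun r => ratfun3_a R + ratfun3_b R - r.+2%:R) 1 (seq_family muJ).
Proof.
apply: (@rational_loop_equation _ _ _ _ _ (fun r a b => a - r.+1%:R)
  (fun r a b => a + b - r.+2%:R) (fun _ => 1) _ _ _ positive_nat
  (fun x => 0 < x) (fun x => 0 < x)).
- by move=> r N a b; apply: ratfun3_valueB => //; exact: ratfun3_value_a.
- move=> r N a b; apply: ratfun3_valueB => //.
  by apply: ratfun3_valueD; [exact: ratfun3_value_a | exact: ratfun3_value_b].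
- by move=> N a b; exact: (value_r 1).
- exact: infinite_positive_nat.
- exact: infinite_positive.
- exact: infinite_positive.
move=> r s _ a b y [N N0 ->] a0 b0 vy.
pose c kappa := ensemble_cumulant (weightJ kappa a b) kappa N.
(* On nonempty lists the factor is the required power [(size s').-1]; in this form the scaling
   relation holds for the empty list too. *)
pose c' kappa s' := kappa^-1 * kappa ^+ size s' * c kappa s'.
have Kgt0 : \forall k \near +oo, (0 : R) < k by exact: nbhs_pinfty_gt.
apply: (@limit_loop_equation _ _ _ (@proper_pinfty_nbhs R) c' y
  (fun k => k^-1 * ((1 - k) * r.+1%:R + k * a))
  (fun k => k^-1 * ((1 - k) * r.+2%:R + (k * a + k * b)))
  (fun k => k * k^-1 ^+ 2) (fun k => k * k * k^-1 ^+ 2)).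
- move=> s' s'r; have s'0 := loop_indices_gt0 s'r.
  have := muJ_cvg s'0 N0 a0 b0 (vy s' s'r).
  apply: cvg_trans; apply: near_eq_cvg; near=> k.
  have k0 : 0 < k by near: k.
  rewrite /c' -[in RHS](prednK s'0) exprS.
  by rewrite mulrA mulVf ?mul1r // gt_eqF.
- apply: (near_pinfty_cvg (g := fun k => k^-1 * r.+1%:R + (a - r.+1%:R))).
    by move=> k k0; field; rewrite gt_eqF.
  rewrite [X in _ --> X](_ : _ = 0 * r.+1%:R + (a - r.+1%:R)); last by rewrite mul0r add0r.
  apply: cvgD; last exact: cvg_cst.
  by apply: cvgM; [exact: invr_pinfty_cvg0 | exact: cvg_cst].
- apply: (near_pinfty_cvg (g := fun k => k^-1 * r.+2%:R + (a + b - r.+2%:R))).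
    by move=> k k0; field; rewrite gt_eqF.
  rewrite [X in _ --> X](_ : _ = 0 * r.+2%:R + (a + b - r.+2%:R)); last by rewrite mul0r add0r.
  apply: cvgD; last exact: cvg_cst.
  by apply: cvgM; [exact: invr_pinfty_cvg0 | exact: cvg_cst].
- apply: (near_pinfty_cvg (g := fun k => k^-1)); last exact: invr_pinfty_cvg0.
  by move=> k k0; field; rewrite gt_eqF.
- apply: (near_pinfty_cvg (g := fun=> 1)); last exact: cvg_cst.
  by move=> k k0; field; rewrite gt_eqF.
near=> k; have k0 : 0 < k by near: k.
apply: (@loop_equation_scaled _ (c k) (c' k) k k^-1).
- move=> s'; rewrite /c' exprVn; field.
  by rewrite gt_eqF // expf_neq0 // gt_eqF.
- by rewrite gt_eqF.
- by rewrite invr_eq0 gt_eqF.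
(* [weightJ k a b] is by definition [weightJs (k * a) (k * b)]. *)
apply: ensemble_loop_equation => //; exact: mulr_gt0.
Unshelve. all: by end_near. Qed.

Lemma low_temperature0 s :
  seq_family muJ (0%N :: s) = ratfun3_N R * (s == [::])%:R.
Proof.
apply/eqP; rewrite -subr_eq0; apply/eqP.
apply: (generically_eq0 infinite_positive_nat infinite_positive infinite_positive).
have [D D0 DP] := generically_regular (seq_family muJ (0%N :: s)).
exists D => // x a b /DP[y vy] [N N0 xE] a0 b0; rewrite {x}xE in vy *.
have := muJ_cvg (s := 0%N :: s) isT N0 a0 b0 vy => cy.
have cN : kappa ^+ size s * ensemble_cumulant (weightJ kappa a b) kappa N (0%N :: s)
    @[kappa --> +oo] --> (N%:R * (s == [::])%:R : R).
  apply: (near_pinfty_cvg (g := fun=> N%:R * (s == [::])%:R)); last exact: cvg_cst.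
  move=> k k0; rewrite (@ensemble_cumulant0 _ N (k * a) (k * b) k) ?mulr_gt0 //.
  by case: s {vy cy DP D D0} => [|x s] /=; rewrite ?expr0 ?mul1r ?mulr0.
rewrite [y](cvg_unique (@Rhausdorff R) cy cN) in vy.
rewrite -(subrr (N%:R * (s == [::])%:R)).
apply: ratfun3_valueB => //; apply: ratfun3_valueM => //; exact: ratfun3_value_N.
Qed.

End LowTemperature.

Section HighTemperature.
Variable muJs : forall n : nat, n.-tuple nat -> ratfun3 R.
Hypothesis muJs_def : high_temperature_coefficients muJs.

(** Restricted to positive a and b, the range in which the loop equations are derived; it is still
    Zariski dense. *)
Let muJs_cvg s alpha a b y : (0 < size s)%N -> 0 < alpha -> 0 < a -> 0 < b ->
  ratfun3_value (seq_family muJs s) alpha a b y ->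
  N%:R^-1 * ensemble_cumulant (weightJs a b) (alpha / N%:R) N s
    @[N --> \oo] --> y.
Proof.
move=> s0 al0 a0 b0.
have a1 : -1 < a by rewrite (lt_trans _ a0) // ltrN10.
have b1 : -1 < b by rewrite (lt_trans _ b0) // ltrN10.
move=> /(muJs_def s0 al0 a1 b1).
by under eq_cvg do rewrite mixed_cumulantE.
Qed.

Let near_cvg (f g : nat -> R) (l : R) : (forall n, (0 < n)%N -> f n = g n) ->
  g n @[n --> \oo] --> l -> f n @[n --> \oo] --> l.
Proof.
move=> fg; apply: cvg_trans; apply: near_eq_cvg; exists 1%N => // n /= n0.
by rewrite fg.
Qed.

Lemma high_temperature_loop :
  leading_loop_equation (fun r => r.+1%:R + ratfun3_a R)
    (fun r => r.+2%:R + (ratfun3_a R + ratfun3_b R)) (ratfun3_N R) (seq_family muJs).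
Proof.
apply: (@rational_loop_equation _ _ _ _ _ (fun r a b => r.+1%:R + a)
  (fun r a b => r.+2%:R + (a + b)) id _ _ _ (fun x => 0 < x)
  (fun x => 0 < x) (fun x => 0 < x)); try exact: infinite_positive.
- by move=> r N a b; apply: ratfun3_valueD => //; exact: ratfun3_value_a.
- move=> r N a b; apply: ratfun3_valueD => //.
  by apply: ratfun3_valueD; [exact: ratfun3_value_a | exact: ratfun3_value_b].
- by move=> N a b; exact: ratfun3_value_N.
move=> r s alpha a b y al0 a0 b0 vy.
pose c N := ensemble_cumulant (weightJs a b) (alpha / N%:R) N.
pose c' N s' := N%:R^-1 * c N s'.
(* The factors 1 stand for eps = 1, so that the coefficients match [loop_equation_scaled]
   literally. *)
apply: (@limit_loop_equation _ _ _ eventually_filter c' y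
  (fun N => 1 * ((1 - alpha / N%:R) * r.+1%:R + a))
  (fun N => 1 * ((1 - alpha / N%:R) * r.+2%:R + (a + b)))
  (fun N => alpha / N%:R * 1 ^+ 2) (fun N => alpha / N%:R * N%:R * 1 ^+ 2)).
- move=> s' s'r; have s'0 := loop_indices_gt0 s'r.
  exact: muJs_cvg s'0 al0 a0 b0 (vy s' s'r).
- rewrite [X in _ --> X](_ : _ = 1 * ((1 - alpha * 0) * r.+1%:R + a)); last by ring.
  apply: cvgM; first exact: cvg_cst.
  apply: cvgD; last exact: cvg_cst.
  apply: cvgM; last exact: cvg_cst.
  by apply: cvgB; [exact: cvg_cst | apply: cvgM; [exact: cvg_cst | exact: invr_nat_cvg0]].
- rewrite [X in _ --> X](_ : _ = 1 * ((1 - alpha * 0) * r.+2%:R + (a + b))); last by ring.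
  apply: cvgM; first exact: cvg_cst.
  apply: cvgD; last exact: cvg_cst.
  apply: cvgM; last exact: cvg_cst.
  by apply: cvgB; [exact: cvg_cst | apply: cvgM; [exact: cvg_cst | exact: invr_nat_cvg0]].
- rewrite [X in _ --> X](_ : _ = alpha * 0 * 1 ^+ 2); last by ring.
  apply: cvgM; last exact: cvg_cst.
  by apply: cvgM; [exact: cvg_cst | exact: invr_nat_cvg0].
- apply: (near_cvg (g := fun=> alpha)); last exact: cvg_cst.
  by move=> n n0; field; rewrite pnatr_eq0 -lt0n.
near=> N; have N0 : (0 < N)%N by near: N; exists 1%N.
have NR0 : (N%:R : R) != 0 by rewrite pnatr_eq0 -lt0n.
apply: (@loop_equation_scaled _ (c N) (c' N) N%:R 1) => //.
- by move=> s'; rewrite /c' expr1n mulr1 mulrA mulfV // mul1r.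
by apply: ensemble_loop_equation => //; rewrite divr_gt0 // ltr0n.
Unshelve. all: by end_near. Qed.

Lemma high_temperature0 s :
  seq_family muJs (0%N :: s) = (s == [::])%:R.
Proof.
apply/eqP; rewrite -subr_eq0; apply/eqP.
apply: (generically_eq0 infinite_positive infinite_positive infinite_positive).
have [D D0 DP] := generically_regular (seq_family muJs (0%N :: s)).
exists D => // alpha a b /DP[y vy] al0 a0 b0.
have := muJs_cvg (s := 0%N :: s) isT al0 a0 b0 vy => cy.
have cN : N%:R^-1 * ensemble_cumulant (weightJs a b) (alpha / N%:R) N (0%N :: s)
    @[N --> \oo] --> ((s == [::])%:R : R).
  apply: (near_cvg (g := fun=> (s == [::])%:R)); last exact: cvg_cst.
  move=> n n0; rewrite ensemble_cumulant0 ?divr_gt0 ?ltr0n //.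
  by rewrite mulrA mulVf ?mul1r // pnatr_eq0 -lt0n.
rewrite [y](cvg_unique (@Rhausdorff R) cy cN) in vy.
by rewrite -(subrr (s == [::])%:R); apply: ratfun3_valueB.
Qed.

End HighTemperature.
End Limits.

(** * The duality between the two systems *)

Section Duality.
Variables (K : fieldType) (sigma : {rmorphism K -> K}) (N a b : K).
Hypotheses (sigmaN : sigma N = - N) (sigmaa : sigma a = - a) (sigmab : sigma b = - b).
Hypothesis N_neq0 : N != 0.
Implicit Types (m : seq nat -> K) (s : seq nat).

Definition dual_family m s : K := (-1) ^+ size s / N * sigma (m s).

Lemma split_term_rmorph m r s :
  sigma (split_term m r s) = split_term (fun s' => sigma (m s')) r s.
Proof.
rewrite rmorph_sum; apply: eq_bigr => u _; rewrite rmorph_sum.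
by apply: eq_bigr => A _; rewrite rmorphM.
Qed.

Lemma merged_term_rmorph m r s :
  sigma (merged_term m r s) = merged_term (fun s' => sigma (m s')) r s.
Proof.
by rewrite rmorph_sum; apply: eq_bigr => i _; rewrite rmorphM /= rmorph_nat.
Qed.

(** This is the rescaling with g = 1/N and eps = -1. Applying [sigma] turns a - (r + 1) into -(a +
    (r + 1)), and the extra argument of the linear terms restores the sign; the split terms gain a
    second 1/N, which theta = N compensates. *)
Lemma dual_family_loop m :
  leading_loop_equation (fun r => a - r.+1%:R) (fun r => a + b - r.+2%:R) 1 m ->
  leading_loop_equation (fun r => r.+1%:R + a) (fun r => r.+2%:R + (a + b)) N
    (dual_family m).
Proof.
move=> Lm r s; pose m' s' := sigma (m s').
have cE s' : dual_family m s' = N^-1 * (-1) ^+ size s' * m' s'.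
  by rewrite /dual_family [_ / _]mulrC.
rewrite !(split_term_scaled cE) !(merged_term_scaled cE) !cE /=.
have := congr1 sigma (Lm r s).
rewrite mul1r !(rmorphB, rmorphD, rmorphM) /= rmorph0 !split_term_rmorph.
rewrite !merged_term_rmorph sigmaa sigmab !rmorph_nat.
rewrite -/(m' (r :: s)) -/(m' (r.+1 :: s)) -/m' => E.
rewrite -[RHS](mulr0 (N^-1 * (-1) ^+ size s)) -E !exprS.
by field.
Qed.

Lemma dual_family0 m s : m (0%N :: s) = N * (s == [::])%:R ->
  dual_family m (0%N :: s) = (s == [::])%:R.
Proof.
move=> m0; rewrite /dual_family m0 rmorphM sigmaN rmorph_nat.
by case: s m0 => [|x s] _ /=; [field | rewrite !mulr0].
Qed.

End Duality.

(** The pivot c2 r + 2 theta m [:: 0] of the recursion for the high temperature system; its value at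
    (1, 1, 1) is positive. *)
Lemma high_temperature_coeff_neq0 (R : realType) r :
  r.+2%:R + (ratfun3_a R + ratfun3_b R) + 2 * ratfun3_N R != 0.
Proof.
have := ratfun3_valueD (ratfun3_valueD (ratfun3_value_nat r.+2 1 1 1)
  (ratfun3_valueD (ratfun3_value_a 1 1 1) (ratfun3_value_b 1 1 (1 : R))))
  (ratfun3_valueM (ratfun3_value_nat 2 1 1 1) (ratfun3_value_N 1 1 1)).
move=> val; apply/eqP => E; move: val; rewrite E.
move/ratfun3_value_inj => /(_ _ (ratfun3_value_nat 0 1 1 1))/eqP.
by rewrite gt_eqF // !addr_gt0 ?mulr_gt0 ?ltr0n.
Qed.

Lemma seq_familyE (R : realType) (mu : forall n : nat, n.-tuple nat -> ratfun3 R)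
  n (p : n.-tuple nat) : mu n p = seq_family mu p.
Proof.
case: p => s sz /=; move: (sz); rewrite -(eqP sz) => sz'.
by congr (mu _ _); exact: val_inj.
Qed.

Theorem corollary4p3 (R : realType)
    (muJ muJs : forall n : nat, n.-tuple nat -> ratfun3 R)
    (muJ_def : low_temperature_coefficients muJ)
    (muJs_def : high_temperature_coefficients muJs)
    (n : nat) (n_gt0 : (0 < n)%N) :
  generating_series (muJs n)
    =1 (fun e => (-1) ^+ n / ratfun3_N R *
                 ratfun3_neg (generating_series (muJ n) e))
  /\ forall p : n.-tuple nat,
       muJs n p = (-1) ^+ n / ratfun3_N R * ratfun3_neg (muJ n p).
Proof.
have key (p : n.-tuple nat) :
    muJs n p = (-1) ^+ n / ratfun3_N R * ratfun3_neg (muJ n p).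
  rewrite !seq_familyE -[n in _ ^+ n](size_tuple p).
  have : tval p != [::] by rewrite -size_eq0 size_tuple -lt0n.
  case: (tval p) => // q s _.
  have dual0 := @dual_family0 _ (@ratfun3_neg R) _ (ratfun3_neg_N R) (ratfun3_N_neq0 R).
  have dual := dual_family_loop (sigma := @ratfun3_neg R) (ratfun3_neg_a R)
    (ratfun3_neg_b R) (ratfun3_N_neq0 R) (low_temperature_loop muJ_def).
  (* The pivot condition bears on the first family, so the high temperature coefficients are put
     there. *)
  apply: (leading_loop_equation_unique _ (high_temperature_loop muJs_def) dual).
  - move=> r; rewrite high_temperature0 // mulr1.
    exact: high_temperature_coeff_neq0.
  - by rewrite high_temperature0 // dual0 // low_temperature0.
  - by move=> s' /negPf s'0; rewrite high_temperature0 // s'0.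
  by move=> s' /negPf s'0; rewrite dual0 ?s'0 // low_temperature0 ?s'0.
split=> // e; rewrite /generating_series; case: ifP => _; first exact: key.
by rewrite ratfun3_neg0 mulr0.
Qed.
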